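(* Let $\mathcal K_0$ be a separable Hilbert space with orthonormal basis $(e_n)_{n\in\mathbb N}$, let $(a_n)_{n\in\mathbb N}$ be real numbers with $a_n\ge 1$, and let $\mathcal K_p$ ($p\in\mathbb Z$) be the associated weighted spaces. If $\bigcup_{p\in\mathbb N}\mathcal K_{-p}$ is nuclear of index $d$, then $\bigcup_{p\in\mathbb N}\Gamma(\mathcal K_{-p})$ is nuclear and, for all integers $p,q$ with $q\ge p+d$ and all $f\in\Gamma(\mathcal K_{-p})$, $g\in\Gamma(\mathcal K_{-q})$, $$\|f\otimes g\|_q\le \|\Gamma(T_{q,p})\|_{HS}\,\|f\|_p\,\|g\|_q\quad\text{and}\quad \|g\otimes f\|_q\le \|\Gamma(T_{q,p})\|_{HS}\,\|f\|_p\,\|g\|_q ,$$ where $$\|\Gamma(T_{q,p})\|_{HS}=\Big(\sum_{\alpha\in\widetilde\ell}a_{\mathbb N}^{-\alpha(q-p)}\Big)^{1/2}=\frac{1}{\sqrt{1-\sum_{n\in\mathbb N}a_n^{-(q-p)}}}<\infty .$$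
   Context: $\mathbb N=\{1,2,\dots\}$. For $p\in\mathbb Z$, $\mathcal K_p$ is the Hilbert space of (formal) sums $\sum_{n\ge1}f_ne_n$ with $f_n\in\mathbb C$ and $\sum_n|f_n|^2a_n^p<\infty$, with the squared norm $\sum_n|f_n|^2a_n^p$; thus $\mathcal K_q\subseteq\mathcal K_p$ for $q\ge p$, and $T_{q,p}:\mathcal K_q\hookrightarrow\mathcal K_p$ denotes the embedding (a contraction). The union $\bigcup_{p\in\mathbb N}\mathcal K_{-p}$ is topologized as the strong dual of the countably Hilbert (Fréchet) space $\bigcap_{p\in\mathbb N}\mathcal K_p$, and similarly $\bigcup_{p\in\mathbb N}\Gamma(\mathcal K_{-p})$ as the strong dual of $\bigcap_{p\in\mathbb N}\Gamma(\mathcal K_p)$. The space $\bigcup_{p}\mathcal K_{-p}$ is nuclear if and only if $\sum_n a_n^{-s}<\infty$ for some $s>0$; ''nuclear of index $d$'' means that it is nuclear and that $d$ is the smallest integer such that $\sum_{n\in\mathbb N}a_n^{-d}<1$. $\Gamma(\mathcal H)=\bigoplus_{n\ge0}\mathcal H^{\otimes n}$ is the full Fock space (Hilbert space tensor powers and Hilbert direct sum, $\mathcal H^{\otimes0}=\mathbb C$). For a contraction $T:\mathcal H_1\to\mathcal H_2$, $\Gamma(T):\Gamma(\mathcal H_1)\to\Gamma(\mathcal H_2)$ is the bounded operator acting on $\mathcal H_1^{\otimes n}$ as $T^{\otimes n}$. $\|\cdot\|_{HS}$ is the Hilbert–Schmidt norm. $\widetilde\ell$ is the free (non-commutative) monoid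 generated by symbols $z_1,z_2,\dots$, with identity the empty word. For $\alpha=z_{i_1}z_{i_2}\cdots z_{i_m}\in\widetilde\ell$ put $e_\alpha=e_{i_1}\otimes\cdots\otimes e_{i_m}$ and $a_{\mathbb N}^{\alpha}=\prod_{k=1}^m a_{i_k}$ (empty product $=1$), and $a_{\mathbb N}^{\alpha s}=(a_{\mathbb N}^\alpha)^s$. Then $\Gamma(\mathcal K_{-p})$ is identified with the space of $f=\sum_{\alpha\in\widetilde\ell}f_\alpha e_\alpha$ with $\|f\|_p^2:=\sum_{\alpha}|f_\alpha|^2a_{\mathbb N}^{-\alpha p}<\infty$; $\|\cdot\|_p$ denotes the norm of $\Gamma(\mathcal K_{-p})$. The product is $f\otimes g=\sum_{\gamma\in\widetilde\ell}\big(\sum_{\alpha\beta=\gamma}f_\alpha g_\beta\big)e_\gamma$. *)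

(* Defs.v *)
From HB Require Import structures.
From mathcomp Require Import all_boot all_order all_algebra complex.
From mathcomp Require Import all_classical all_reals all_analysis.

Set Implicit Arguments.
Unset Strict Implicit.
Unset Printing Implicit Defensive.
Import Order.TTheory GRing.Theory Num.Theory.
Import numFieldNormedType.Exports.

Local Open Scope classical_set_scope.
Local Open Scope complex_scope.
Local Open Scope ring_scope.

(** Formal sums [\sum_i f_i e_i] with complex coefficients are represented by
    their coefficient families.  The index set {1, 2, ...} of the basis is
    represented by [nat] (only its cardinality matters), so that the free
    monoid on the symbols z_1, z_2, ... is [seq nat]. *)
Definition coefs (R : realType) (I : Type) := I -> R[i]^o.

Notation cabs := ComplexField.Normc.normc.

Section WeightedEll2.
Context {R : realType} {I : choiceType}.
Implicit Types (w : I -> R) (f g : coefs R I).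

(** The norm [(\sum_i |f_i|^2 w_i)^(1/2)], equal to [+oo] outside the space. *)
Definition wnorm w f : \bar R :=
  sqrte (\esum_(i in [set: I]) (cabs (f i) ^+ 2 * w i)%:E).

Definition ell2 w : set (coefs R I) := [set f | (wnorm w f < +oo)%E].

(** Unconditional sums; meaningful for absolutely summable families. *)
Definition rsum (u : I -> R) : R :=
  fine (\esum_(i in [set: I]) (EFin \o u)^\+ i
        - \esum_(i in [set: I]) (EFin \o u)^\- i)%E.

Definition csum (z : I -> R[i]) : R[i] :=
  (rsum (fun i => complex.Re (z i))) +i* (rsum (fun i => complex.Im (z i))).

Definition winner w f g : R[i] :=
  csum (fun i => f i * conjc (g i) * (w i)%:C).

(** All orthonormal bases of [ell2 w] are equipotent to [I] (the vectors [e_i],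
    suitably normalized, form one when [w] is positive), so they are indexed
    by [I]. *)
Definition orthonormal_basis w (u : I -> coefs R I) : Prop :=
  [/\ forall k, ell2 w (u k),
      forall k l, winner w (u k) (u l) = (k == l)%:R
    & forall f, ell2 w f -> forall e : R, 0 < e ->
        exists (s : seq I) (c : I -> R[i]),
          (wnorm w (f - \sum_(k <- s) c k *: u k)%R < e%:E)%E].

End WeightedEll2.

(** The Hilbert-Schmidt norm of [T : ell2 w1 -> ell2 w2], computed in an
    arbitrarily chosen orthonormal basis of [ell2 w1]. *)
Definition hs_norm (R : realType) (I J : choiceType) (w1 : I -> R)
    (w2 : J -> R) (T : coefs R I -> coefs R J) : \bar R :=
  let u := xget (fun=> 0) [set u | orthonormal_basis w1 u] in
  sqrte (\esum_(k in [set: I]) (wnorm w2 (T (u k)) ^+ 2)%E).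

Section Fock.
Context {R : realType}.
Implicit Types (w : nat -> R).

(** If [H = ell2 w], the vectors [e_(i_1) (x) ... (x) e_(i_m)] are orthogonal
    with squared norm [w i_1 * ... * w i_m] and total in [H^(x)m], so the full
    Fock space over [H] is [ell2 (fock_weight w)]. *)
Definition fock_weight w (alpha : seq nat) : R := \prod_(i <- alpha) w i.

(** The elementary tensor [x_1 (x) ... (x) x_m], in the summand [H^(x)m]. *)
Definition tensor (xs : seq (coefs R nat)) : coefs R (seq nat) :=
  fun alpha => if size alpha == size xs
    then \prod_(xi <- zip xs alpha) (xi.1 xi.2 : R[i]) else 0.

Definition is_second_quantization (w1 w2 : nat -> R)
    (T : coefs R nat -> coefs R nat)
    (G : coefs R (seq nat) -> coefs R (seq nat)) : Prop :=
  [/\ forall f, ell2 (fock_weight w1) f -> ell2 (fock_weight w2) (G f),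
      forall (c : R[i]) f g, ell2 (fock_weight w1) f ->
        ell2 (fock_weight w1) g -> G (c *: f + g) = c *: G f + G g,
      exists M : R, forall f, ell2 (fock_weight w1) f ->
        (wnorm (fock_weight w2) (G f) <= M%:E * wnorm (fock_weight w1) f)%E
    & forall xs : seq (coefs R nat), (forall x, x \in xs -> ell2 w1 x) ->
        G (tensor xs) = tensor (map T xs)].

(** [Gamma(T)] for a contraction [T : ell2 w1 -> ell2 w2]: the unique bounded
    operator acting on elementary tensors as [T (x) ... (x) T]; its values
    outside the Fock space [ell2 (fock_weight w1)] are irrelevant. *)
Definition second_quantization (w1 w2 : nat -> R)
    (T : coefs R nat -> coefs R nat) :
    coefs R (seq nat) -> coefs R (seq nat) :=
  xget (fun=> 0) [set G | is_second_quantization w1 w2 T G].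

(** [(f (x) g)_gamma = \sum_(alpha beta = gamma) f_alpha g_beta], the sum being
    over the positions at which the word [gamma] can be cut in two. *)
Definition fock_prod (f g : coefs R (seq nat)) : coefs R (seq nat) :=
  fun gamma => \sum_(k < (size gamma).+1)
    (f (take k gamma) * g (drop k gamma) : R[i]).

End Fock.

(** Nuclearity of a locally convex space.  The space is a linear subspace [V]
    of the ambient module [E] and its topology is the one generated by a family
    [P] of seminorms on [V].  As in Pietsch's monograph, [V] is nuclear if for
    every continuous seminorm [p] there is a continuous seminorm [q >= p] such
    that the canonical map from [V / ker q] to [V / ker p] is nuclear.
    Functionals bounded by a multiple of [q] are the elements of the dual of
    [V / ker q]. *)
Section Nuclear.
Context {R : realType} {E : lmodType R[i]}.
Implicit Types (V : set E) (P : set (E -> R)) (p q : E -> R).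

Definition seminorm_on V p : Prop :=
  (forall x y, V x -> V y -> p (x + y) <= p x + p y) /\
  (forall (c : R[i]) x, V x -> p (c *: x) = cabs c * p x).

Definition continuous_seminorm V P p : Prop :=
  seminorm_on V p /\
  exists (s : seq (E -> R)) (M : R), (forall r, r \in s -> P r) /\
    forall x, V x -> p x <= M * \sum_(r <- s) r x.

Definition linear_on V (phi : E -> R[i]) : Prop :=
  forall (c : R[i]) x y, V x -> V y -> phi (c *: x + y) = c * phi x + phi y.

Definition nuclear_canonical_map V q p : Prop :=
  exists (phi : nat -> E -> R[i]) (c : nat -> R) (y : nat -> E),
    [/\ forall n, linear_on V (phi n),
        forall n, 0 <= c n /\ forall x, V x -> cabs (phi n x) <= c n * q x,
        forall n, V (y n),
        cvgn (series (fun n => c n * p (y n)))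
      & forall x, V x ->
          (fun N => p (x - \sum_(n < N) phi n x *: y n)) @ \oo --> (0 : R)].

Definition nuclear V P : Prop :=
  forall p, continuous_seminorm V P p ->
    exists q, [/\ continuous_seminorm V P q,
                  forall x, V x -> p x <= q x
                & nuclear_canonical_map V q p].

End Nuclear.

(** For a scale of spaces [H_p = ell2 (W p)], the union of the [H_(-p)] with
    the topology of the strong dual of the countably Hilbert space
    [\bigcap_(p >= 1) H_p], under the pairing [<x, f> = \sum_i x_i f_i]: the
    topology of uniform convergence on the bounded subsets of the latter. *)
Section StrongDual.
Context {R : realType} {I : choiceType}.
Implicit Types (W : int -> I -> R) (B : set (coefs R I)).

Definition union_space W : set (coefs R I) :=
  [set f | exists2 p : nat, (0 < p)%N & ell2 (W (- p%:Z)) f].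

Definition bounded_in_intersection W B : Prop :=
  forall p : nat, (0 < p)%N ->
    exists M : R, forall x, B x -> (wnorm (W p%:Z) x <= M%:E)%E.

Definition dual_seminorm B (f : coefs R I) : R :=
  sup [set cabs (csum (fun i => x i * f i)) | x in B].

Definition nuclear_union W : Prop :=
  nuclear (union_space W)
    [set dual_seminorm B | B in bounded_in_intersection W].

End StrongDual.

Section Scale.
Context {R : realType}.
Implicit Types (a : nat -> R) (p q d : int).

Definition Kweight a p : nat -> R := fun n => a n ^ p.

Definition GammaK a p : set (coefs R (seq nat)) :=
  ell2 (fock_weight (Kweight a p)).

(** [\|f\|_p] is the norm of [Gamma(K_(-p))]. *)
Definition Gnorm a p (f : coefs R (seq nat)) : \bar R :=
  wnorm (fock_weight (Kweight a (- p))) f.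

(** The embedding [T_(q,p) : K_q -> K_p] acts as the identity on
    coefficients. *)
Definition GammaT a q p : coefs R (seq nat) -> coefs R (seq nat) :=
  second_quantization (Kweight a q) (Kweight a p) id.

Definition GammaT_hs a q p : \bar R :=
  hs_norm (fock_weight (Kweight a q)) (fock_weight (Kweight a p))
    (GammaT a q p).

Definition weight_sum a p : \bar R :=
  \esum_(n in [set: nat]) (a n ^ (- p))%:E.

Definition nuclear_of_index a d : Prop :=
  [/\ nuclear_union (Kweight a),
      (weight_sum a d < 1)%E
    & forall k : int, (weight_sum a k < 1)%E -> d <= k].

End Scale.

(* Main.v *)
Require Import Defs.
From mathcomp Require Import all_boot all_order all_algebra complex.
From mathcomp Require Import all_classical all_reals all_analysis.
From mathcomp Require Import ring lra.

(** Put [A alpha = a^alpha] for a word [alpha].  The weight of [Gamma(K_p)] at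
    [alpha] is [A alpha ^ p], so the Fock spaces form the scale of weighted l^2
    spaces given by the powers of the single function [A >= 1] on words.

    Sorting the words by their first letter shows that the sum [S_r] of
    [A alpha ^ (- r)] over all words satisfies [S_r = 1 + t S_r], where [t] is
    the sum of the [a_n ^ (- r)]; hence [S_r = 1 / (1 - t)] when [t < 1]
    ([esum_fock_weight]).  The index [d] provides [t < 1] for all [r >= d], and
    everything follows from this finiteness.

    Hilbert-Schmidt norm.  A bounded operator that fixes elementary tensors
    fixes the Fock space, because the coordinate vectors are elementary tensors
    and span a dense subspace ([second_quantization_id_unique]); so
    [Gamma(T_(q,p))] is the inclusion.  By Parseval's identity, the squared
    Hilbert-Schmidt norm of an inclusion of weighted l^2 spaces is the sum of
    the ratios of the weights, in every orthonormal basis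
    ([hs_norm_embedding]).  Here this is [S_(q-p)].

    Product estimate.  Apply the Cauchy-Schwarz inequality to the sum over the
    cuts [gamma = alpha beta] of a word, giving the cut the weight
    [A alpha ^ (- (q - p))].  The total weight is at most [S_(q-p)], and since
    [A] is multiplicative the remaining factor is the convolution of
    [|f_alpha|^2 A alpha ^ (- p)] and [|g_beta|^2 A beta ^ (- q)], whose sum over
    [gamma] is the product of the squared norms ([sqnorm_fock_prodl]).  Using
    the weight [A beta ^ (- (q - p))] instead handles the opposite product.

    Nuclearity.  A scale of powers of [A] with [A ^ (- d)] summable is nuclear
    ([nuclear_power_scale]): a bounded set of the intersection lies below a
    family [b] that decays faster than all powers of [A], so the seminorms
    [\sum_i b_i |f_i|] generate the strong topology; passing from [b] to
    [b A ^ d] turns the expansion in coordinate vectors into a nuclear one. *)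

Set Implicit Arguments.
Unset Strict Implicit.
Unset Printing Implicit Defensive.
Import Order.TTheory GRing.Theory Num.Theory.
Import numFieldNormedType.Exports.
Local Open Scope classical_set_scope.
Local Open Scope complex_scope.
Local Open Scope ring_scope.

(** * Unordered sums of nonnegative families *)

Section NonnegativeSums.
Context {R : realType}.
Local Open Scope ereal_scope.

Lemma finite_uniq_seq (T : choiceType) (A : set T) :
  finite_set A -> exists2 s : seq T, uniq s & A = [set` s].
Proof.
move=> /finite_seqP[s ->]; exists (undup s); first exact: undup_uniq.
by apply/seteqP; split => i /=; rewrite mem_undup.
Qed.

Lemma big_le_esum (I : choiceType) (F : I -> \bar R) (s : seq I) :
  (forall i, 0 <= F i) -> uniq s ->
  \sum_(i <- s) F i <= \esum_(i in [set: I]) F i.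
Proof.
move=> F0 us; apply: esum_ge; exists [set` s].
  by split => //; exact: finite_seq.
by rewrite -fsbig_seq.
Qed.

Lemma esum_le_big (I : choiceType) (F : I -> \bar R) (M : \bar R) :
  (forall s, uniq s -> \sum_(i <- s) F i <= M) ->
  \esum_(i in [set: I]) F i <= M.
Proof.
move=> FM; apply: ge_ereal_sup => _ [A [/finite_uniq_seq[s us ->] _] <-].
by rewrite -fsbig_seq//; exact: FM.
Qed.

Lemma le_term_esum (I : choiceType) (F : I -> \bar R) i :
  (forall i, 0 <= F i) -> F i <= \esum_(i in [set: I]) F i.
Proof. by move=> F0; have := @big_le_esum _ F [:: i] F0; rewrite big_seq1; exact. Qed.

Lemma esumZ (I : choiceType) (c : R) (F : I -> \bar R) :
  (0 <= c)%R -> (forall i, 0 <= F i) ->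
  \esum_(i in [set: I]) (c%:E * F i) = c%:E * \esum_(i in [set: I]) F i.
Proof.
have le_esumZ (b : R) (G : I -> \bar R) : (0 <= b)%R -> (forall i, 0 <= G i) ->
    \esum_(i in [set: I]) (b%:E * G i) <= b%:E * \esum_(i in [set: I]) G i.
  move=> b0 G0; apply: esum_le_big => s us.
  by rewrite -ge0_sume_distrr// lee_wpmul2l ?lee_fin// big_le_esum.
move=> c0 F0; apply/eqP; rewrite eq_le le_esumZ//=.
have [<-|c_neq0] := eqVneq 0%R c.
  by rewrite mul0e esum_ge0// => i _; rewrite mul0e.
have {c_neq0}c0 : (0 < c)%R by rewrite lt_neqAle c_neq0.
have cF0 i : 0 <= c%:E * F i by rewrite mule_ge0// lee_fin ltW.
have {1}-> : \esum_(i in [set: I]) F i =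
    \esum_(i in [set: I]) (c^-1%:E * (c%:E * F i)).
  by apply: eq_esum => i _; rewrite muleA -EFinM mulVf ?gt_eqF// mul1e.
have /(lee_wpmul2l (x := c%:E)) : \esum_(i in [set: I]) (c^-1%:E * (c%:E * F i))
    <= c^-1%:E * \esum_(i in [set: I]) (c%:E * F i).
  by apply: le_esumZ => //; rewrite invr_ge0 ltW.
rewrite [X in _ -> _ <= X]muleA -EFinM mulfV ?gt_eqF// mul1e; apply.
by rewrite lee_fin ltW.
Qed.

Lemma esum_interchange (I J : choiceType) (F : I -> J -> \bar R) :
  (forall i j, 0 <= F i j) ->
  \esum_(i in [set: I]) \esum_(j in [set: J]) F i j =
  \esum_(j in [set: J]) \esum_(i in [set: I]) F i j.
Proof.
move=> F0; rewrite !esum_esum//.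
rewrite (@reindex_esum _ _ _ ([set: J] `*`` fun=> [set: I])
  ([set: I] `*`` fun=> [set: J]) (fun k => (k.2, k.1)))//.
split => //; first by move=> [i j] [k l] _ _ [-> ->].
by move=> [i j] _; exists (j, i).
Qed.

(** The remainders of a convergent sum over an arbitrary index set tend to 0
    along the finite subsets. *)
Lemma esum_tail (I : choiceType) (F : I -> \bar R) (e : R) :
  (forall i, 0 <= F i) -> \esum_(i in [set: I]) F i < +oo -> (0 < e)%R ->
  exists s : seq I, uniq s /\ forall t : seq I, {subset s <= t} ->
    \esum_(i in [set: I]) (if i \in t then 0 else F i) < e%:E.
Proof.
move=> F0 Foo e0.
have Ffin : \esum_(i in [set: I]) F i \is a fin_num.
  by rewrite ge0_fin_numE// esum_ge0.
have [_ [_ [/finite_uniq_seq[s us ->] _] <-]] := ub_ereal_sup_adherent e0 Ffin.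
rewrite -fsbig_seq//= => lt_e.
exists s; split => // t st.
pose G i := if i \in t then 0 else F i.
have G0 i : 0 <= G i by rewrite /G; case: ifP.
have : \sum_(i <- s) F i + \esum_(i in [set: I]) G i
    <= \esum_(i in [set: I]) F i.
  have -> : \sum_(i <- s) F i = \sum_(i \in [set` s]) F i.
    by rewrite -fsbig_seq.
  rewrite -(esum_fset (finite_seq s))// esum_mkcond -esumD//; last by move=> i _; case: ifP.
  apply: le_esum => i _; rewrite /G; case: ifPn => [|_].
    by rewrite inE /= => /st ->; rewrite adde0.
  by rewrite add0e; case: ifP.
have sfin : \sum_(i <- s) F i \is a fin_num.
  by rewrite ge0_fin_numE ?sume_ge0//; apply: le_lt_trans Foo; exact: big_le_esum.
have : \esum_(i in [set: I]) F i < \sum_(i <- s) F i + e%:E.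
  by rewrite -lteBlDr.
move=> /[swap] /le_lt_trans /[apply].
by rewrite lteD2lE.
Qed.

End NonnegativeSums.

(** * Unconditional sums of complex families *)

Section ComplexModulus.
Context {R : realType}.
Implicit Types x y : R[i].

Lemma cabs_ge0 x : 0 <= cabs x.
Proof. by case: x => a b; exact: sqrtr_ge0. Qed.

Lemma sqr_cabs x : cabs x ^+ 2 = complex.Re x ^+ 2 + complex.Im x ^+ 2.
Proof. by case: x => a b /=; rewrite sqr_sqrtr ?addr_ge0 ?sqr_ge0. Qed.

Lemma mulc_conj x : x * conjc x = (cabs x ^+ 2)%:C.
Proof.
rewrite sqr_cabs; case: x => a b; apply/eqP; rewrite eq_complex/=.
by apply/andP; split; apply/eqP; ring.
Qed.

Lemma cabs_conj x : cabs (conjc x) = cabs x.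
Proof. by case: x => a b /=; rewrite sqrrN. Qed.

Lemma cabs_real (r : R) : cabs r%:C = `|r|.
Proof. by rewrite /= expr0n addr0 sqrtr_sqr. Qed.

Lemma Re_le_cabs x : `|complex.Re x| <= cabs x.
Proof. by case: x => a b /=; rewrite -sqrtr_sqr ler_wsqrtr// lerDl sqr_ge0. Qed.

Lemma Im_le_cabs x : `|complex.Im x| <= cabs x.
Proof. by case: x => a b /=; rewrite -sqrtr_sqr ler_wsqrtr// lerDr sqr_ge0. Qed.

Lemma cabs_sum (J : Type) (s : seq J) (z : J -> R[i]) :
  cabs (\sum_(j <- s) z j) <= \sum_(j <- s) cabs (z j).
Proof.
elim: s => [|j s ih]; first by rewrite !big_nil ComplexField.Normc.normc0.
by rewrite !big_cons (le_trans (le_normcD _ _))// lerD2l.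
Qed.

Lemma sqr_cabsD x y : cabs (x + y) ^+ 2 <= 2 * cabs x ^+ 2 + 2 * cabs y ^+ 2.
Proof.
rewrite !sqr_cabs; case: x y => a b [c d] /=.
have := sqr_ge0 (a - c); have := sqr_ge0 (b - d); nra.
Qed.

End ComplexModulus.

Section ComplexSums.
Context {R : realType} {I : choiceType}.
Implicit Types (x y u v : I -> R) (z : I -> R[i]).

Definition pos_summable x : Prop := (\esum_(i in [set: I]) (x i)%:E < +oo)%E.

Definition abs_summable z : Prop := pos_summable (fun i => cabs (z i)).

Lemma pos_summable_le x y :
  (forall i, x i <= y i) -> pos_summable y -> pos_summable x.
Proof. by move=> xy; apply: le_lt_trans; apply: le_esum => i _; rewrite lee_fin. Qed.

Lemma pos_summable_fin x : (forall i, 0 <= x i) -> pos_summable x ->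
  (\esum_(i in [set: I]) (x i)%:E \is a fin_num)%E.
Proof. by move=> x0 sx; rewrite ge0_fin_numE// esum_ge0// => i _; rewrite lee_fin. Qed.

Lemma esumDr x y : (forall i, 0 <= x i) -> (forall i, 0 <= y i) ->
  (\esum_(i in [set: I]) (x i + y i)%:E =
   \esum_(i in [set: I]) (x i)%:E + \esum_(i in [set: I]) (y i)%:E)%E.
Proof.
by move=> x0 y0; rewrite -esumD// => i _; rewrite lee_fin.
Qed.

Lemma esumZr (c : R) x : 0 <= c -> (forall i, 0 <= x i) ->
  (\esum_(i in [set: I]) (c * x i)%:E = c%:E * \esum_(i in [set: I]) (x i)%:E)%E.
Proof. by move=> c0 x0; rewrite -esumZ// => i; rewrite lee_fin. Qed.

Lemma pos_summableD x y : (forall i, 0 <= x i) -> (forall i, 0 <= y i) ->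
  pos_summable x -> pos_summable y -> pos_summable (fun i => x i + y i).
Proof. by move=> x0 y0 sx sy; rewrite /pos_summable esumDr// lte_add_pinfty. Qed.

Lemma pos_summableZ (c : R) x : 0 <= c -> (forall i, 0 <= x i) ->
  pos_summable x -> pos_summable (fun i => c * x i).
Proof.
move=> c0 x0 sx; rewrite /pos_summable esumZr//.
have /fineK <- := pos_summable_fin x0 sx.
by rewrite -EFinM ltry.
Qed.

Lemma rsumB x y : (forall i, 0 <= x i) -> (forall i, 0 <= y i) ->
  pos_summable x -> pos_summable y ->
  rsum (fun i => x i - y i) =
  fine (\esum_(i in [set: I]) (x i)%:E)%E - fine (\esum_(i in [set: I]) (y i)%:E)%E.
Proof.
move=> x0 y0 sx sy; have fx := pos_summable_fin x0 sx.
have fy := pos_summable_fin y0 sy.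
rewrite -fineB// -(@esumB _ _ setT (EFin \o x) (EFin \o y)) => [//|||i _|i _]; rewrite ?lee_fin//.
- by rewrite /summable; under eq_esum => i _ do rewrite /= ger0_norm//.
- by rewrite /summable; under eq_esum => i _ do rewrite /= ger0_norm//.
Qed.

Let ppart u i := Num.max (u i) 0.
Let npart u i := Num.max (- u i) 0.

Let ppart_ge0 u i : 0 <= ppart u i. Proof. by rewrite /ppart le_max lexx orbT. Qed.
Let npart_ge0 u i : 0 <= npart u i. Proof. by rewrite /npart le_max lexx orbT. Qed.
Let partB u i : u i = ppart u i - npart u i.
Proof. by rewrite /ppart /npart; case: (lerP (u i) 0); case: (lerP (- u i) 0); lra. Qed.
Let ppart_summable u : pos_summable (fun i => `|u i|) -> pos_summable (ppart u).
Proof.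
by apply: pos_summable_le => i; rewrite /ppart ge_max normr_ge0 ler_norm.
Qed.
Let npart_summable u : pos_summable (fun i => `|u i|) -> pos_summable (npart u).
Proof.
by apply: pos_summable_le => i; rewrite /npart ge_max normr_ge0 -normrN ler_norm.
Qed.

Lemma rsumE u : pos_summable (fun i => `|u i|) ->
  rsum u = fine (\esum_(i in [set: I]) (ppart u i)%:E)%E
           - fine (\esum_(i in [set: I]) (npart u i)%:E)%E.
Proof.
move=> su; rewrite -rsumB//; [|exact: ppart_summable|exact: npart_summable].
by congr rsum; apply/funext => i; exact: partB.
Qed.

Lemma rsumD u v : pos_summable (fun i => `|u i|) ->
  pos_summable (fun i => `|v i|) ->
  rsum (fun i => u i + v i) = rsum u + rsum v.
Proof.
move=> su sv.
have [pu nu] := (ppart_summable su, npart_summable su).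
have [pv nv] := (ppart_summable sv, npart_summable sv).
have -> : (fun i => u i + v i) =
    (fun i => (ppart u i + ppart v i) - (npart u i + npart v i)).
  by apply/funext => i; rewrite {1}(partB u) {1}(partB v); ring.
rewrite rsumB; try by [move=> i; exact: addr_ge0|exact: pos_summableD].
rewrite !esumDr// !fineD; try exact: pos_summable_fin.
by rewrite !rsumE//; ring.
Qed.

Lemma rsumZ (c : R) u : pos_summable (fun i => `|u i|) ->
  rsum (fun i => c * u i) = c * rsum u.
Proof.
move=> su; have [pu nu] := (ppart_summable su, npart_summable su).
have [c0|/ltW c0] := lerP 0 c.
  have -> : (fun i => c * u i) = (fun i => c * ppart u i - c * npart u i).
    by apply/funext => i; rewrite {1}(partB u); ring.
  rewrite rsumB; try by [move=> i; exact: mulr_ge0|exact: pos_summableZ].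
  by rewrite !esumZr// !fineM ?rsumE//= ?mulrBr//; exact: pos_summable_fin.
have Nc0 : 0 <= - c by rewrite oppr_ge0.
have -> : (fun i => c * u i) = (fun i => - c * npart u i - - c * ppart u i).
  by apply/funext => i; rewrite {1}(partB u); ring.
rewrite rsumB; try by [move=> i; exact: mulr_ge0|exact: pos_summableZ].
rewrite !esumZr// !fineM//=; try by [exact: pos_summable_fin].
by rewrite rsumE//; ring.
Qed.

Lemma rsum_ge0E x : (forall i, 0 <= x i) -> pos_summable x ->
  rsum x = fine (\esum_(i in [set: I]) (x i)%:E)%E.
Proof.
move=> x0 sx; have z0 : (\esum_(i in [set: I]) (0 : R)%:E = 0)%E by rewrite esum1.
have -> : fine (\esum_(i in [set: I]) (x i)%:E)%E =
    fine (\esum_(i in [set: I]) (x i)%:E)%E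
    - fine (\esum_(i in [set: I]) (0 : R)%:E)%E by rewrite z0 subr0.
rewrite -rsumB//.
  by congr rsum; apply/funext => i; rewrite subr0.
by rewrite /pos_summable z0.
Qed.

Lemma abs_summable_Re z : abs_summable z ->
  pos_summable (fun i => `|complex.Re (z i)|).
Proof. by apply: pos_summable_le => i; exact: Re_le_cabs. Qed.

Lemma abs_summable_Im z : abs_summable z ->
  pos_summable (fun i => `|complex.Im (z i)|).
Proof. by apply: pos_summable_le => i; exact: Im_le_cabs. Qed.

Let rsum_lin3 (b c : R) u v w : pos_summable (fun i => `|u i|) ->
  pos_summable (fun i => `|v i|) -> pos_summable (fun i => `|w i|) ->
  rsum (fun i => b * u i + (c * v i + w i)) = b * rsum u + (c * rsum v + rsum w).
Proof.
move=> su sv sw.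
have scale (e : R) x : pos_summable (fun i => `|x i|) ->
    pos_summable (fun i => `|e * x i|).
  move=> sx; have := pos_summableZ (normr_ge0 e) (fun i => normr_ge0 (x i)) sx.
  by apply: pos_summable_le => i; rewrite normrM.
have add x y : pos_summable (fun i => `|x i|) -> pos_summable (fun i => `|y i|) ->
    pos_summable (fun i => `|x i + y i|).
  move=> sx sy; have := pos_summableD (fun i => normr_ge0 (x i))
    (fun i => normr_ge0 (y i)) sx sy.
  by apply: pos_summable_le => i; exact: ler_normD.
have [scu scv] := (scale b _ su, scale c _ sv).
rewrite (rsumD scu (add _ _ scv sw)) (rsumD scv sw).
by rewrite (rsumZ b su) (rsumZ c sv).
Qed.

Lemma csum_linear (c : R[i]) z z' : abs_summable z -> abs_summable z' ->
  csum (fun i => c * z i + z' i) = c * csum z + csum z'.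
Proof.
move=> sz sz'.
have [rz iz] := (abs_summable_Re sz, abs_summable_Im sz).
have [rz' iz'] := (abs_summable_Re sz', abs_summable_Im sz').
case: c => a b.
have ReE i : complex.Re ((a +i* b) * z i + z' i) =
    a * complex.Re (z i) + (- b * complex.Im (z i) + complex.Re (z' i)).
  by case: (z i) (z' i) => ? ? [? ?] /=; ring.
have ImE i : complex.Im ((a +i* b) * z i + z' i) =
    a * complex.Im (z i) + (b * complex.Re (z i) + complex.Im (z' i)).
  by case: (z i) (z' i) => ? ? [? ?] /=; ring.
rewrite /csum (funext ReE) (funext ImE).
rewrite (rsum_lin3 a (- b) rz iz rz') (rsum_lin3 a b iz rz iz').
by apply/eqP; rewrite eq_complex/=; apply/andP; split; apply/eqP; ring.
Qed.

Lemma csum_conj z : abs_summable z ->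
  csum (fun i => conjc (z i)) = conjc (csum z).
Proof.
move=> sz; have iz := abs_summable_Im sz.
have ReE i : complex.Re (conjc (z i)) = complex.Re (z i) by case: (z i).
have ImE i : complex.Im (conjc (z i)) = -1 * complex.Im (z i).
  by case: (z i) => /= u v; rewrite mulN1r.
by rewrite /csum (funext ReE) (funext ImE) (rsumZ _ iz) mulN1r.
Qed.

Lemma csum_real x : (forall i, 0 <= x i) -> pos_summable x ->
  csum (fun i => (x i)%:C) = (fine (\esum_(i in [set: I]) (x i)%:E)%E)%:C.
Proof.
move=> x0 sx; have e0 : (\esum_(i in [set: I]) (0 : R)%:E = 0)%E by rewrite esum1.
have r0 : rsum (fun _ : I => 0 : R) = 0.
  by rewrite rsum_ge0E /pos_summable// e0// ltry.
rewrite /csum [X in _ +i* X](_ : _ = 0); last exact: r0.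
by rewrite [X in X +i* _](_ : _ = rsum x)// rsum_ge0E.
Qed.

Lemma csum0 : csum (fun _ : I => 0 : R[i]) = 0.
Proof.
have := @csum_real (fun=> 0); rewrite /pos_summable esum1//= => -> //.
Qed.

Lemma esum_single (x : I -> \bar R) j : (0 <= x j)%E ->
  (forall i, i != j -> x i = 0%E) ->
  (\esum_(i in [set: I]) x i)%E = x j.
Proof.
move=> xj0 x0; rewrite -[RHS](esum_set1 xj0) [RHS]esum_mkcond.
apply: eq_esum => i _; case: ifPn => //; rewrite notin_setE /= => /eqP; exact: x0.
Qed.

Lemma rsum_single u j : (forall i, i != j -> u i = 0) -> rsum u = u j.
Proof.
move=> u0.
have su : pos_summable (fun i => `|u i|).
  by rewrite /pos_summable (esum_single (j := j)) ?ltry ?lee_fin// => i /u0 ->; rewrite normr0.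
have p0 i : i != j -> (ppart u i)%:E = 0%E by move=> /u0; rewrite /ppart => ->; rewrite maxxx.
have n0 i : i != j -> (npart u i)%:E = 0%E.
  by move=> /u0; rewrite /npart => ->; rewrite oppr0 maxxx.
by rewrite rsumE// (esum_single _ p0) ?lee_fin// (esum_single _ n0) ?lee_fin//= -partB.
Qed.

Lemma csum_single z j : (forall i, i != j -> z i = 0) -> csum z = z j.
Proof.
move=> z0; rewrite /csum !(rsum_single (j := j)) => [|i /z0 ->//|i /z0 ->//].
by case: (z j).
Qed.

(** The triangle inequality, obtained from the real case by rotating the sum
    onto the real axis. *)
Lemma cabs_csum_le z : abs_summable z ->
  ((cabs (csum z))%:E <= \esum_(i in [set: I]) (cabs (z i))%:E)%E.
Proof.
move=> sz; set t := csum z.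
have [->|t0] := eqVneq t 0.
  rewrite ComplexField.Normc.normc0 esum_ge0// => i _; rewrite lee_fin; exact: cabs_ge0.
have tp : 0 < cabs t.
  rewrite lt_def cabs_ge0 andbT; apply: contra t0 => /eqP/ComplexField.Normc.eq0_normc ->//.
pose c : R[i] := conjc t / (cabs t)%:C.
have c1 : cabs c = 1.
  rewrite /c ComplexField.Normc.normcM ComplexField.Normc.normcV cabs_conj cabs_real.
  by rewrite ger0_norm ?cabs_ge0// mulfV// gt_eqF.
have sz0 : abs_summable (fun=> 0).
  rewrite /abs_summable /pos_summable esum1 ?ltry// => i _.
  by rewrite ComplexField.Normc.normc0.
have ct : csum (fun i => c * z i) = (cabs t)%:C.
  have := csum_linear c sz sz0; rewrite csum0; under eq_fun do rewrite addr0.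
  move=> ->; rewrite addr0 -/t /c mulrAC [conjc t * t]mulrC mulc_conj.
  rewrite expr2 rmorphM mulrK// unitfE; apply/eqP => -[] /eqP; by rewrite gt_eqF.
have scz : abs_summable (fun i => c * z i).
  by apply: pos_summable_le sz => i; rewrite ComplexField.Normc.normcM c1 mul1r.
have -> : cabs t = rsum (fun i => complex.Re (c * z i)).
  by move/(congr1 (@complex.Re _)): ct => /= <-.
rewrite rsumE; last exact: abs_summable_Re.
set u := fun i => complex.Re (c * z i).
have su : pos_summable (fun i => `|u i|) by exact: abs_summable_Re.
apply: (@le_trans _ _ (fine (\esum_(i in [set: I]) (ppart u i)%:E)%E)%:E).
  rewrite lee_fin lerBlDr lerDl fine_ge0// esum_ge0// => i _; rewrite lee_fin//.
rewrite fineK; last exact: pos_summable_fin (ppart_summable su).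
apply: le_esum => i _; rewrite lee_fin /ppart ge_max cabs_ge0 andbT.
rewrite (le_trans (ler_norm _))// (le_trans (Re_le_cabs _))//.
by rewrite ComplexField.Normc.normcM c1 mul1r.
Qed.

End ComplexSums.

(** * Weighted square-summable families *)

Section WeightedSpaces.
Context {R : realType} {I : choiceType}.
Implicit Types (f g h : coefs R I) (w : I -> R).

Definition sqnorm w f : \bar R :=
  (\esum_(i in [set: I]) (cabs (f i) ^+ 2 * w i)%:E)%E.

Definition vec (j : I) : coefs R I := fun i => (i == j)%:R.

Context (w : I -> R) (w_ge0 : forall i, 0 <= w i).

Lemma sqnorm_term_ge0 f i : 0 <= cabs (f i) ^+ 2 * w i.
Proof. by rewrite mulr_ge0 ?sqr_ge0. Qed.
Hint Resolve sqnorm_term_ge0 : core.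

Lemma sqnorm_ge0 f : (0 <= sqnorm w f)%E.
Proof. by apply: esum_ge0 => i _; rewrite lee_fin. Qed.

Lemma sqr_wnorm f : (wnorm w f ^+ 2 = sqnorm w f)%E.
Proof. by rewrite sqr_sqrte ?sqnorm_ge0. Qed.

Lemma ell2E f : ell2 w f = pos_summable (fun i => cabs (f i) ^+ 2 * w i).
Proof.
apply/propext; rewrite /ell2 /pos_summable /= -!ge0_fin_numE ?sqrte_ge0 ?sqnorm_ge0//.
by rewrite sqrte_fin_num ?sqnorm_ge0.
Qed.

Lemma sqnorm_fin f : ell2 w f -> (sqnorm w f \is a fin_num)%E.
Proof. by rewrite ell2E; exact: pos_summable_fin. Qed.

Lemma le_sqnorm f g : (forall i, cabs (f i) <= cabs (g i)) ->
  (sqnorm w f <= sqnorm w g)%E.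
Proof.
move=> fg; apply: le_esum => i _; rewrite lee_fin ler_wpM2r//.
by rewrite lerXn2r ?nnegrE ?cabs_ge0.
Qed.

Lemma ell2_le f g : (forall i, cabs (f i) <= cabs (g i)) ->
  ell2 w g -> ell2 w f.
Proof. by move=> fg; rewrite !ell2E; exact: le_lt_trans (le_sqnorm fg). Qed.

Lemma ell2_0 : ell2 w (0 : coefs R I).
Proof.
rewrite ell2E /pos_summable esum1 ?ltry// => i _.
by rewrite ComplexField.Normc.normc0 expr0n mul0r.
Qed.

Lemma ell2_lin (c : R[i]) f g : ell2 w f -> ell2 w g -> ell2 w (c *: f + g).
Proof.
rewrite !ell2E => sf sg.
have c0 : 0 <= 2 * cabs c ^+ 2 by rewrite mulr_ge0// sqr_ge0.
have := pos_summableD (fun i => mulr_ge0 c0 (sqnorm_term_ge0 f i))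
  (fun i => mulr_ge0 (ler0n R 2) (sqnorm_term_ge0 g i))
  (pos_summableZ c0 (sqnorm_term_ge0 f) sf)
  (pos_summableZ (ler0n R 2) (sqnorm_term_ge0 g) sg).
apply: pos_summable_le => i; rewrite [X in _ <= X + _]mulrA [X in _ <= _ + X]mulrA -mulrDl.
rewrite ler_wpM2r//; apply: le_trans (sqr_cabsD (c * f i) (g i)) _.
by rewrite ComplexField.Normc.normcM exprMn mulrA.
Qed.

Lemma ell2_sum (J : Type) (s : seq J) (c : J -> R[i]) (u : J -> coefs R I) :
  (forall k, ell2 w (u k)) -> ell2 w (\sum_(k <- s) c k *: u k).
Proof.
move=> wu; elim: s => [|k s ih]; first by rewrite big_nil; exact: ell2_0.
by rewrite big_cons; exact: ell2_lin.
Qed.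

Lemma ell2B f g : ell2 w f -> ell2 w g -> ell2 w (f - g).
Proof.
move=> sf sg; rewrite addrC -scaleN1r; exact: ell2_lin.
Qed.

Lemma inner_summable f g : ell2 w f -> ell2 w g ->
  abs_summable (fun i => f i * conjc (g i) * (w i)%:C).
Proof.
rewrite !ell2E => sf sg.
have := pos_summableD (sqnorm_term_ge0 f) (sqnorm_term_ge0 g) sf sg.
apply: pos_summable_le => i; rewrite -mulrDl.
rewrite !ComplexField.Normc.normcM cabs_conj cabs_real ger0_norm// ler_wpM2r//.
by have := cabs_ge0 (f i); have := cabs_ge0 (g i); nra.
Qed.

Lemma winner_linear (c : R[i]) f g h : ell2 w f -> ell2 w g -> ell2 w h ->
  winner w (c *: f + g) h = c * winner w f h + winner w g h.
Proof.
move=> sf sg sh; rewrite /winner -csum_linear; try exact: inner_summable.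
congr csum; apply/funext => i; rewrite -[(c *: f + g) i]/(c * f i + g i : R[i]).
by rewrite !mulrA -!mulrDl.
Qed.

Lemma winnerC f g : ell2 w f -> ell2 w g ->
  winner w g f = conjc (winner w f g).
Proof.
move=> sf sg; rewrite /winner -csum_conj; last exact: inner_summable.
congr csum; apply/funext => i.
case: (f i) (g i) => a b [c d]; apply/eqP; rewrite eq_complex/=.
by apply/andP; split; apply/eqP; ring.
Qed.

Lemma winner_self f : ell2 w f -> winner w f f = (fine (sqnorm w f))%:C.
Proof.
rewrite ell2E => sf; rewrite -csum_real//; congr csum; apply/funext => i.
by rewrite mulc_conj -rmorphM.
Qed.

Lemma winner0 h : ell2 w h -> winner w 0 h = 0.
Proof.
move=> sh; rewrite -[RHS](@csum0 R I); congr csum; apply/funext => i.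
by rewrite !mul0r.
Qed.

Lemma winner_suml (J : Type) (s : seq J) (c : J -> R[i]) (u : J -> coefs R I) h :
  (forall k, ell2 w (u k)) -> ell2 w h ->
  winner w (\sum_(k <- s) c k *: u k) h = \sum_(k <- s) c k * winner w (u k) h.
Proof.
move=> wu sh; elim: s => [|k s ih]; first by rewrite !big_nil winner0.
by rewrite !big_cons winner_linear ?ih//; exact: ell2_sum.
Qed.

Lemma complete_square (J : Type) (s : seq J) (c x : J -> R[i]) :
  - (\sum_(k <- s) conjc (c k) * x k + \sum_(k <- s) c k * conjc (x k))
  + \sum_(k <- s) c k * conjc (c k) =
  (- (\sum_(k <- s) cabs (x k) ^+ 2) + \sum_(k <- s) cabs (c k - x k) ^+ 2)%:C.
Proof.
rewrite -sumrN -!big_split/= -sumrN -big_split (rmorph_sum (real_complex R)).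
apply: eq_bigr => k _; rewrite !sqr_cabs.
by case: (c k) (x k) => a b [d e]; apply/eqP; rewrite eq_complex/=;
  apply/andP; split; apply/eqP; ring.
Qed.

(** Completing the square: among the combinations of finitely many orthonormal
    vectors, the Fourier coefficients of [f] give the one closest to [f].  This
    yields both halves of the Parseval identity below. *)
Lemma sqnorm_sub_fourier (J : choiceType) (u : J -> coefs R I) f (s : seq J)
    (c : J -> R[i]) :
  (forall k, ell2 w (u k)) ->
  (forall k l, winner w (u k) (u l) = (k == l)%:R) ->
  ell2 w f -> uniq s ->
  fine (sqnorm w (f - \sum_(k <- s) c k *: u k)) =
  fine (sqnorm w f) - \sum_(k <- s) cabs (winner w f (u k)) ^+ 2
  + \sum_(k <- s) cabs (c k - winner w f (u k)) ^+ 2.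
Proof.
move=> wu onu sf us; set v := \sum_(k <- s) _.
have conjB (x y : R[i]) : conjc (x - y) = conjc x - conjc y by exact: rmorphB.
have conjM (x y : R[i]) : conjc (x * y) = conjc x * conjc y by exact: rmorphM.
have sv : ell2 w v by exact: ell2_sum.
have subE g : ell2 w g -> winner w (f - v) g = winner w f g - winner w v g.
  by move=> sg; rewrite addrC -scaleN1r winner_linear// mulN1r addrC.
have sfv := ell2B sf sv.
have vf : winner w v f = \sum_(k <- s) c k * conjc (winner w f (u k)).
  by rewrite winner_suml//; apply: eq_bigr => k _; rewrite (winnerC sf).
have vfJ : conjc (winner w v f) = \sum_(k <- s) conjc (c k) * winner w f (u k).
  rewrite vf; transitivity (\sum_(k <- s) conjc (c k * conjc (winner w f (u k)))).
    exact: rmorph_sum.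
  by apply: eq_bigr => k _; rewrite conjM conjcK.
have vu k : k \in s -> winner w v (u k) = c k.
  move=> ks; rewrite winner_suml// (bigD1_seq k)//= onu eqxx mulr1.
  by rewrite big1 ?addr0// => l lk; rewrite onu (negbTE lk) mulr0.
have vv : winner w v v = \sum_(k <- s) c k * conjc (c k).
  rewrite {1}/v winner_suml//; apply: eq_big_seq => k ks.
  by rewrite (winnerC sv)// vu.
have expand : winner w (f - v) (f - v) =
    winner w f f - (conjc (winner w v f) + winner w v f) + winner w v v.
  rewrite subE// (winnerC sfv sf) (winnerC sfv sv) !subE// !conjB.
  rewrite -(winnerC sf sf) -(winnerC sv sv) -(winnerC sf sv); ring.
have norms : (fine (sqnorm w f))%:C = winner w f f by rewrite winner_self.
apply: (@complexI R); rewrite -winner_self// expand vfJ vf vv.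
rewrite -addrA complete_square -norms -rmorphD; congr (_%:C).
by rewrite addrA.
Qed.

(** Parseval's identity.  Completeness of the basis is given by approximation;
    the approximating combination may list a basis vector several times, and
    its coefficients are first collected. *)
Lemma parseval (u : I -> coefs R I) f :
  orthonormal_basis w u -> ell2 w f ->
  (\esum_(k in [set: I]) (cabs (winner w f (u k)) ^+ 2)%:E = sqnorm w f)%E.
Proof.
move=> [wu onu dense] sf; have ffin := sqnorm_fin sf.
apply/eqP; rewrite eq_le; apply/andP; split.
  apply: esum_le_big => s us; rewrite sumEFin -(fineK ffin) lee_fin.
  have := sqnorm_sub_fourier (fun k => winner w f (u k)) wu onu sf us.
  rewrite [X in _ = _ + X]big1 ?addr0 => [|k _].
    move=> e; rewrite -subr_ge0 -e fine_ge0//; exact: sqnorm_ge0.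
  by rewrite subrr ComplexField.Normc.normc0 expr0n.
apply/lee_addgt0Pr => e e0.
have [|s0 [c0 lt_e]] := dense _ sf (Num.sqrt e); first by rewrite sqrtr_gt0.
set s := undup s0; pose c k := c0 k *+ count_mem k s0.
have collect : \sum_(k <- s0) c0 k *: u k = \sum_(k <- s) c k *: u k.
  rewrite -(big_undup_iterop_count _ _ xpredT); apply: eq_bigr => k _.
  by rewrite /c -scalerMnl.
have us : uniq s by exact: undup_uniq.
have {lt_e} : fine (sqnorm w (f - \sum_(k <- s) c k *: u k)) <= e.
  rewrite collect in lt_e.
  rewrite -lee_fin fineK; last by apply: sqnorm_fin; apply: ell2B => //; exact: ell2_sum.
  by rewrite -lee_sqrt ?lee_fin ?ltW.
rewrite (sqnorm_sub_fourier c wu onu sf us) => le_e.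
apply: le_trans (leeD2r _ (big_le_esum _ us)); last by move=> k; rewrite lee_fin sqr_ge0.
rewrite sumEFin -(fineK ffin) -EFinD lee_fin.
have : 0 <= \sum_(k <- s) cabs (c k - winner w f (u k)) ^+ 2.
  by apply: sumr_ge0 => k _; exact: sqr_ge0.
by move: le_e; set a := fine _; set b := \sum_(_ <- _) _; set d := \sum_(_ <- _) _; lra.
Qed.

Lemma vec_sum (s : seq I) (c : I -> R[i]) i : uniq s ->
  (\sum_(k <- s) c k *: vec k) i = if i \in s then c i else 0.
Proof.
move=> us; rewrite fct_sumE.
have E j : (c j *: vec j) i = c j * (i == j)%:R :> R[i] by [].
under eq_bigr => j _ do rewrite E.
case: ifPn => si.
  rewrite (bigD1_seq i)//= eqxx mulr1 big1 ?addr0// => j /negbTE ji.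
  by rewrite eq_sym ji mulr0.
rewrite big1_seq// => j /= js; case: eqP => [ij|_]; last by rewrite mulr0.
by rewrite ij js in si.
Qed.

Lemma sub_vec_sum f (s : seq I) i : uniq s ->
  (f - \sum_(k <- s) f k *: vec k) i = if i \in s then 0 else f i.
Proof.
move=> us; rewrite fctE /= [X in _ + X](_ : _ = - (if i \in s then f i else 0)).
  by case: ifP => _; rewrite ?subrr ?subr0.
by rewrite -vec_sum.
Qed.

Lemma sqnorm_vec j : sqnorm w (vec j) = (w j)%:E.
Proof.
rewrite /sqnorm (esum_single (j := j)) ?lee_fin// => [|i /negbTE ij].
  by rewrite /vec eqxx ComplexField.Normc.normc1 expr1n mul1r.
by rewrite /vec ij ComplexField.Normc.normc0 expr0n mul0r.
Qed.

Lemma ell2_vec j : ell2 w (vec j).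
Proof. by rewrite ell2E /pos_summable -/(sqnorm w (vec j)) sqnorm_vec ltry. Qed.

(** Finitely supported families are dense. *)
Lemma sqnorm_truncation f (e : R) : ell2 w f -> 0 < e ->
  exists s : seq I, uniq s /\ forall t, uniq t -> {subset s <= t} ->
    (sqnorm w (f - \sum_(k <- t) f k *: vec k)%R < e%:E)%E.
Proof.
rewrite ell2E => sf e0.
have [|s [us tail]] := esum_tail _ sf e0; first by move=> i; rewrite lee_fin.
exists s; split => // t ut /tail; apply: le_lt_trans; apply: le_esum => i _.
rewrite sub_vec_sum//; case: ifP => // _.
by rewrite ComplexField.Normc.normc0 expr0n mul0r.
Qed.

End WeightedSpaces.

(** * Hilbert-Schmidt norm of a weighted embedding *)

Section Embeddings.
Context {R : realType} {I : choiceType}.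
Implicit Types (f : coefs R I) (w : I -> R).

Lemma sqrte_lt (x : \bar R) (e : R) :
  (0 <= x)%E -> 0 < e -> (x < (e ^+ 2)%:E)%E -> (sqrte x < e%:E)%E.
Proof.
move=> x0 e0; apply: contraTT; rewrite -!leNgt => ex.
rewrite -lee_sqrt//; apply: le_trans ex.
by rewrite /= sqrtr_sqr gtr0_norm.
Qed.

Lemma winner_vec w i f : winner w (vec i) f = conjc (f i) * (w i)%:C.
Proof.
rewrite /winner (csum_single (j := i)) => [|j /negbTE ji].
  by rewrite /vec eqxx mul1r.
by rewrite /vec ji !mul0r.
Qed.

Lemma normalized_vec_basis w : (forall i, 0 < w i) ->
  orthonormal_basis w (fun j => ((Num.sqrt (w j))^-1)%:C *: vec j).
Proof.
move=> w0; have w_ge0 i : 0 <= w i by exact: ltW.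
have sqrt_unit i : Num.sqrt (w i) != 0 by rewrite gt_eqF// sqrtr_gt0.
split.
- move=> k; rewrite -[_ *: _]addr0; apply: ell2_lin => //.
    exact: ell2_vec.
  exact: ell2_0.
- move=> k l; rewrite /winner (csum_single (j := k)) => [|i /negbTE ik]; last first.
    by rewrite -[(_ *: vec k) i]/(_ * (i == k)%:R : R[i]) ik mulr0 !mul0r.
  rewrite -[(_ *: vec k) k]/(_ * (k == k)%:R : R[i]) eqxx mulr1.
  rewrite -[(_ *: vec l) k]/(_ * (k == l)%:R : R[i]).
  case: eqVneq => [<-|_]; last by rewrite mulr0 conjc0 mulr0 mul0r.
  rewrite mulr1 conjc_real -!rmorphM -invfM -expr2 sqr_sqrtr// mulVf//.
  by rewrite gt_eqF.
- move=> f sf e e0.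
  have [|s [us /(_ s us (fun _ => id)) lt_e]] := sqnorm_truncation w_ge0 sf (e := e ^+ 2).
    by rewrite exprn_gt0.
  exists s, (fun k => f k * (Num.sqrt (w k))%:C).
  under eq_bigr => k _ do
    rewrite scalerA -mulrA -rmorphM mulfV// rmorph1 mulr1.
  by apply: sqrte_lt => //; exact: sqnorm_ge0.
Qed.

(** Expanding the squared norms of the images of the basis vectors and
    exchanging the summations reduces the computation, one coordinate at a time,
    to Parseval's identity for [vec i]; this is why the Hilbert-Schmidt norm does
    not depend on the basis. *)
Lemma hs_norm_embedding w1 w2 (T : coefs R I -> coefs R I) :
  (forall i, 0 < w1 i) -> (forall i, 0 <= w2 i) ->
  (forall f, ell2 w1 f -> T f = f) ->
  hs_norm w1 w2 T = sqrte (\esum_(i in [set: I]) (w2 i / w1 i)%:E)%E.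
Proof.
move=> w1_gt0 w2_ge0 TE; have w1_ge0 i : 0 <= w1 i by exact: ltW.
rewrite /hs_norm; set u := xget _ _; congr sqrte.
have onb_u : orthonormal_basis w1 u.
  by apply: (@xgetPex _ _ [set v | orthonormal_basis w1 v]);
    exists (fun j => ((Num.sqrt (w1 j))^-1)%:C *: vec j); exact: normalized_vec_basis.
have [wu _ _] := onb_u.
under eq_esum => k _ do rewrite TE// sqr_wnorm//.
rewrite esum_interchange; last by move=> k i; rewrite lee_fin sqnorm_term_ge0.
apply: eq_esum => i _.
have := parseval w1_ge0 onb_u (ell2_vec w1_ge0 i); rewrite sqnorm_vec// => pars.
pose r := w2 i / w1 i ^+ 2.
transitivity (r%:E * (w1 i)%:E)%E; last first.
  by rewrite -EFinM /r expr2; congr (_%:E); field; rewrite gt_eqF.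
rewrite -pars -esumZr; first last.
- by move=> k; exact: sqr_ge0.
- by rewrite /r divr_ge0// sqr_ge0.
apply: eq_esum => k _; congr (_%:E).
rewrite winner_vec ComplexField.Normc.normcM cabs_conj cabs_real ger0_norm// exprMn.
by rewrite /r; field; rewrite gt_eqF.
Qed.

End Embeddings.

(** * Second quantization of an embedding *)

Section SecondQuantization.
Context {R : realType}.
Implicit Types (w : nat -> R).

Lemma fock_weight_gt0 w alpha : (forall n, 0 < w n) -> 0 < fock_weight w alpha.
Proof. by move=> w0; apply: prodr_gt0. Qed.

Lemma tensor_vec (alpha : seq nat) :
  tensor (map (@vec R nat) alpha) = vec alpha.
Proof.
apply/funext => beta; rewrite /tensor size_map.
elim: alpha beta => [|i alpha ih] [|j beta]//=.
  by rewrite big_nil.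
rewrite eqSS big_cons /=; have := ih beta.
rewrite -[vec (i :: alpha) _]/((j :: beta == i :: alpha)%:R : R[i]).
rewrite -[vec alpha _]/((beta == alpha)%:R : R[i]) eqseq_cons -mulnb natrM => <-.
by case: ifP => _; rewrite ?mulr0.
Qed.

Lemma id_second_quantization w1 w2 :
  (forall n, 0 < w2 n) -> (forall n, w2 n <= w1 n) ->
  is_second_quantization w1 w2 id id.
Proof.
move=> w2_gt0 w21; have w1_gt0 n : 0 < w1 n by exact: lt_le_trans (w21 n).
have le_fock alpha : fock_weight w2 alpha <= fock_weight w1 alpha.
  by apply: ler_prod => n _; rewrite w21 ltW.
have le_norm f : (wnorm (fock_weight w2) f <= wnorm (fock_weight w1) f)%E.
  rewrite /wnorm lee_sqrt; last by apply: sqnorm_ge0 => alpha; rewrite ltW ?fock_weight_gt0.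
  by apply: le_esum => alpha _; rewrite lee_fin ler_wpM2l// sqr_ge0.
split => //.
- by move=> f; apply: le_lt_trans.
- by exists 1 => f _; rewrite mul1e.
- by move=> xs _; rewrite map_id.
Qed.

(** The values on the vectors [vec alpha], which are elementary tensors,
    determine [G] on finite combinations, and boundedness extends this to their
    closure.  Truncations of [f] that retain the coordinate [beta] make the
    comparison at [beta] immediate. *)
Lemma second_quantization_id_unique w1 w2 G :
  (forall n, 0 < w1 n) -> (forall n, 0 < w2 n) ->
  is_second_quantization w1 w2 id G ->
  forall f, ell2 (fock_weight w1) f -> G f = f.
Proof.
move=> w1_gt0 w2_gt0 [_ linG [M bndG] tensG] f sf.
have W1_ge0 alpha : 0 <= fock_weight w1 alpha by rewrite ltW ?fock_weight_gt0.
have W2_ge0 alpha : 0 <= fock_weight w2 alpha by rewrite ltW ?fock_weight_gt0.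
have vec_ell2 alpha : ell2 (fock_weight w1) (vec alpha) by exact: ell2_vec.
have G0 : G 0 = 0.
  have z : ell2 (fock_weight w1) 0 by exact: ell2_0.
  have := linG 1 0 0 z z.
  by rewrite !scale1r addr0 => /(congr1 (fun g => g - G 0)); rewrite subrr addrK.
have Gvec alpha : G (vec alpha) = vec alpha.
  rewrite -{1}tensor_vec tensG ?map_id ?tensor_vec// => x /mapP[n _ ->].
  by apply: ell2_vec => k; exact: ltW.
have Gsum (s : seq (seq nat)) (c : seq nat -> R[i]) :
    G (\sum_(k <- s) c k *: vec k) = \sum_(k <- s) c k *: vec k.
  elim: s => [|k s ih]; first by rewrite big_nil.
  by rewrite big_cons linG ?ih ?Gvec//; exact: ell2_sum.
apply/funext => beta; apply/eqP; rewrite -subr_eq0; apply/eqP.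
apply: ComplexField.Normc.eq0_normc; apply/eqP; rewrite -sqrf_eq0.
rewrite eq_le sqr_ge0 andbT -(pmulr_lle0 _ (fock_weight_gt0 beta w2_gt0)).
have M2_gt0 : 0 < M ^+ 2 + 1 by rewrite ltr_wpDl// sqr_ge0.
apply/ler_addgt0Pr => e e0; rewrite add0r.
have [|s [us tail]] := sqnorm_truncation W1_ge0 sf (e := e / (M ^+ 2 + 1)).
  by rewrite divr_gt0.
pose t := undup (beta :: s).
have ut : uniq t by exact: undup_uniq.
have {}tail := tail t ut _.
pose v := \sum_(k <- t) f k *: vec k.
have sv : ell2 (fock_weight w1) v by exact: ell2_sum.
have sfv : ell2 (fock_weight w1) (f - v) by exact: ell2B.
have fE : f = 1 *: (f - v) + v by rewrite scale1r subrK.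
have diffE : (G f - f) beta = G (f - v) beta.
  rewrite {1}fE linG// Gsum scale1r -/v.
  rewrite -[LHS]/(G (f - v) beta + v beta - f beta) /v vec_sum//.
  by rewrite mem_undup mem_head addrK.
rewrite -[G f beta - f beta]/((G f - f) beta) diffE.
have := bndG _ sfv; set nG := wnorm _ _; set nfv := wnorm _ _ => bnd.
have sqr_bnd : (sqnorm (fock_weight w2) (G (f - v)%R) <=
    (M ^+ 2)%:E * sqnorm (fock_weight w1) (f - v)%R)%E.
  rewrite -!sqr_wnorm// -/nG -/nfv EFin_expe !expe2 muleACA.
  by apply: lee_pmul => //; exact: sqrte_ge0.
rewrite -lee_fin; apply: le_trans (le_trans _ sqr_bnd) _.
  apply: (@le_term_esum _ _ (fun alpha => (cabs (G (f - v) alpha) ^+ 2 *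
    fock_weight w2 alpha)%:E) beta) => alpha.
  by rewrite lee_fin mulr_ge0 ?sqr_ge0.
have -> : e%:E = ((M ^+ 2 + 1)%:E * (e / (M ^+ 2 + 1))%:E)%E.
  by rewrite -EFinM mulrC divfK// gt_eqF.
apply: lee_pmul => //.
- by rewrite lee_fin sqr_ge0.
- exact: sqnorm_ge0.
- by rewrite lee_fin lerDl.
- apply/ltW/tail => k ks; by rewrite mem_undup inE ks orbT.
Qed.

Lemma second_quantization_id w1 w2 f :
  (forall n, 0 < w2 n) -> (forall n, w2 n <= w1 n) ->
  ell2 (fock_weight w1) f -> second_quantization w1 w2 id f = f.
Proof.
move=> w2_gt0 w21; have w1_gt0 n : 0 < w1 n by exact: lt_le_trans (w21 n).
apply: (second_quantization_id_unique w1_gt0 w2_gt0).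
apply: (@xgetPex _ _ [set G | is_second_quantization w1 w2 id G]).
by exists id; exact: id_second_quantization.
Qed.

End SecondQuantization.

(** * Sums over the free monoid *)

Section Words.
Context {R : realType}.

Lemma fock_weight_cons (x : nat -> R) n alpha :
  fock_weight x (n :: alpha) = x n * fock_weight x alpha.
Proof. exact: big_cons. Qed.

Lemma fock_weight_cat (x : nat -> R) alpha beta :
  fock_weight x (alpha ++ beta) = fock_weight x alpha * fock_weight x beta.
Proof. exact: big_cat. Qed.

Lemma fock_weight_ge0 (x : nat -> R) alpha :
  (forall n, 0 <= x n) -> 0 <= fock_weight x alpha.
Proof. by move=> x0; apply: prodr_ge0. Qed.

Lemma esum_words (F : seq nat -> \bar R) : (forall alpha, 0 <= F alpha)%E ->
  (\esum_(alpha in [set: seq nat]) F alpha = F [::] +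
   \esum_(n in [set: nat]) \esum_(alpha in [set: seq nat]) F (n :: alpha))%E.
Proof.
move=> F0; rewrite (esumID [set [::]])//; congr (_ + _)%E.
  by rewrite setTI esum_set1.
rewrite setTI esum_esum// (@reindex_esum _ _ _ ([set: nat] `*`` fun=> [set: seq nat])
  _ (fun k => k.1 :: k.2))//.
split; first by move=> k _.
  by move=> [i s] [j t] _ _ [-> ->].
by move=> [|n alpha] //= _; exists (n, alpha).
Qed.

(** The sum [S] over all words satisfies [S = 1 + t S] by splitting off the
    first letter.  This determines [S] once it is known to be finite, which
    follows from the same recursion for the sums over the words of bounded
    length: these stay below the fixed point [1 / (1 - t)]. *)
Lemma esum_fock_weight (x : nat -> R) (t : R) :
  (forall n, 0 <= x n) -> (\esum_(n in [set: nat]) (x n)%:E = t%:E)%E -> t < 1 ->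
  (\esum_(alpha in [set: seq nat]) (fock_weight x alpha)%:E = ((1 - t)^-1)%:E)%E.
Proof.
move=> x0 xt t1; have W0 alpha := fock_weight_ge0 alpha x0.
have t0 : 0 <= t.
  by rewrite -lee_fin -xt esum_ge0// => n _; rewrite lee_fin.
have u0 : 0 < 1 - t by rewrite subr_gt0.
pose W m alpha : R := if (size alpha < m)%N then fock_weight x alpha else 0.
have Wm0 m alpha : 0 <= W m alpha by rewrite /W; case: ifP.
have letter (c : R) : 0 <= c ->
    (\esum_(n in [set: nat]) ((x n)%:E * c%:E) = (t * c)%:E)%E.
  move=> c0; under eq_esum => n _ do rewrite muleC.
  by rewrite esumZ ?xt// -EFinM mulrC.
have T_le m : (\esum_(alpha in [set: seq nat]) (W m alpha)%:E <= ((1 - t)^-1)%:E)%E.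
  elim: m => [|m ih].
    rewrite esum1 ?lee_fin ?invr_ge0 ?ltW// => alpha _.
  rewrite (esum_words (F := fun alpha => (W m.+1 alpha)%:E)) => [|alpha]; last first.
    by rewrite lee_fin.
  under eq_esum => n _.
    under eq_esum => alpha _.
      rewrite (_ : W m.+1 (n :: alpha) = x n * W m alpha); last first.
        by rewrite /W /= ltnS fock_weight_cons; case: ifP; rewrite ?mulr0.
      over.
    rewrite esumZr//.
    over.
  have -> : W m.+1 [::] = 1 by rewrite /W /= /fock_weight big_nil.
  apply: (@le_trans _ _ (1%:E + \esum_(n in [set: nat]) ((x n)%:E * ((1 - t)^-1)%:E))%E).
    by rewrite leeD2l// le_esum// => n _; rewrite lee_wpmul2l// lee_fin.
  rewrite letter; last by rewrite invr_ge0 ltW.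
  rewrite -EFinD lee_fin le_eqVlt; apply/orP; left.
  by apply/eqP; field; rewrite gt_eqF.
have S_le : (\esum_(alpha in [set: seq nat]) (fock_weight x alpha)%:E
    <= ((1 - t)^-1)%:E)%E.
  apply: esum_le_big => s us; pose m := (\max_(alpha <- s) size alpha).+1.
  apply: le_trans (T_le m); apply: le_trans (big_le_esum _ us); last first.
    by move=> alpha; rewrite lee_fin.
  rewrite big_seq [leRHS]big_seq; apply: lee_sum => alpha sa.
  by rewrite /W ltnS leq_bigmax_seq.
have Sfin : (\esum_(alpha in [set: seq nat]) (fock_weight x alpha)%:E \is a fin_num)%E.
  rewrite ge0_fin_numE ?(le_lt_trans S_le) ?ltry//.
  by apply: esum_ge0 => alpha _; rewrite lee_fin.
have W0e alpha : (0 <= (fock_weight x alpha)%:E)%E by rewrite lee_fin.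
have := esum_words W0e.
under [X in _ = (_ + X)%E -> _]eq_esum => n _.
  under eq_esum => alpha _ do rewrite fock_weight_cons.
  rewrite esumZr//.
  over.
rewrite -(fineK Sfin); set S := fine _.
have S0 : 0 <= S by apply: fine_ge0; apply: esum_ge0 => alpha _.
have -> : fock_weight x [::] = 1 by rewrite /fock_weight big_nil.
rewrite letter// -EFinD => -[SE]; congr (_%:E).
have u_neq0 : 1 - t != 0 by rewrite gt_eqF.
by apply: (mulfI u_neq0); rewrite mulfV// mulrBl mul1r {1}SE addrK.
Qed.

(** Each pair of words is cut out of exactly one word, at one position. *)
Lemma esum_cuts_le (F G : seq nat -> R) :
  (forall alpha, 0 <= F alpha) -> (forall alpha, 0 <= G alpha) ->
  pos_summable G ->
  (\esum_(gamma in [set: seq nat])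
     (\sum_(k < (size gamma).+1) F (take k gamma) * G (drop k gamma))%:E <=
   (\esum_(alpha in [set: seq nat]) (F alpha)%:E) *
   (\esum_(alpha in [set: seq nat]) (G alpha)%:E))%E.
Proof.
move=> F0 G0 sG; apply: esum_le_big => s us.
pose cuts := [seq (take k gamma, drop k gamma) |
  gamma <- s, k <- iota 0 (size gamma).+1].
have ucuts : uniq cuts.
  apply: allpairs_uniq_dep => // [gamma _|]; first exact: iota_uniq.
  move=> [gamma k] [gamma' k'] /allpairsPdep[g1 [k1 [_ kg1 [-> ->]]]].
  move=> /allpairsPdep[g2 [k2 [_ kg2 [-> ->]]]] /= [eq_take eq_drop].
  have eg : g1 = g2 by rewrite -(cat_take_drop k1 g1) eq_take eq_drop cat_take_drop.
  move: kg1 kg2; rewrite !mem_iota !add0n !ltnS /= => kg1 kg2.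
  by rewrite -eg in kg2 *; rewrite -(size_takel kg1) eq_take -eg size_takel.
have -> : (\sum_(gamma <- s) (\sum_(k < (size gamma).+1)
    F (take k gamma) * G (drop k gamma))%:E =
    \sum_(c <- cuts) (F c.1 * G c.2)%:E)%E.
  rewrite big_allpairs_dep/=; apply: eq_bigr => gamma _.
  rewrite -sumEFin.
  by rewrite -(big_mkord xpredT (fun k => (F (take k gamma) * G (drop k gamma))%:E)).
apply: (le_trans (big_le_esum _ ucuts)) => [c|].
  by rewrite lee_fin mulr_ge0.
have sum_G := pos_summable_fin G0 sG.
have -> : [set: seq nat * seq nat] = [set: seq nat] `*`` (fun=> [set: seq nat]).
  by apply/seteqP; split.
rewrite -(@esum_esum _ _ _ _ (fun=> setT) (fun a b => (F a * G b)%:E)); last first.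
  by move=> a b _ _; rewrite lee_fin mulr_ge0.
have GE : (\esum_(b in [set: seq nat]) (G b)%:E)%E =
  (fine (\esum_(b in [set: seq nat]) (G b)%:E)%E)%:E by rewrite fineK.
under eq_esum => a _ do rewrite esumZr// GE muleC.
have B0 : 0 <= fine (\esum_(b in [set: seq nat]) (G b)%:E)%E.
  by rewrite fine_ge0// esum_ge0// => b _; rewrite lee_fin.
rewrite (esumZ B0 (F := fun a => (F a)%:E)) => [|a]; last by rewrite lee_fin.
by rewrite -GE muleC.
Qed.

(** The Cauchy-Schwarz inequality, arranged to avoid square roots of [s]. *)
Lemma sqr_sum_le n (x s : 'I_n.+1 -> R) : (forall k, 0 < s k) ->
  (\sum_k x k) ^+ 2 <= (\sum_k s k) * (\sum_k x k ^+ 2 / s k).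
Proof.
move=> s0; set X := \sum_k x k; set T := \sum_k s k.
have T0 : 0 < T.
  by rewrite /T big_ord_recl ltr_wpDr//; apply: sumr_ge0 => k _; exact: ltW.
(* c is the slope minimizing the sum of the squares (x k - c * s k)^2 / s k *)
pose c := X / T.
have : \sum_k (2 * c * x k - c ^+ 2 * s k) <= \sum_k x k ^+ 2 / s k.
  apply: ler_sum => k _; rewrite ler_pdivlMr// -subr_ge0.
  rewrite (_ : _ - _ = (x k - c * s k) ^+ 2); [exact: sqr_ge0|by ring].
rewrite sumrB -!mulr_sumr -/X -/T => /(ler_wpM2l (ltW T0)).
by apply: le_trans; rewrite le_eqVlt; apply/orP; left; apply/eqP;
  rewrite /c; field; rewrite gt_eqF.
Qed.

(** In [f (x) g], estimate the sum over the cuts of a word [gamma] by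
    Cauchy-Schwarz, weighting the cut [gamma = alpha beta] by [s alpha] or by
    [s beta].  The words [alpha] (or [beta]) that occur are pairwise distinct,
    so the total weight is at most the sum [S] of [s] over all words. *)
Section ProductEstimate.
Context (V W s : seq nat -> R) (S : R).
Context (W_ge0 : forall alpha, 0 <= W alpha) (s_gt0 : forall alpha, 0 < s alpha).
Context (VE : forall alpha, V alpha = W alpha * s alpha)
  (V_cat : forall alpha beta, V (alpha ++ beta) = V alpha * V beta)
  (sumS : (\esum_(alpha in [set: seq nat]) (s alpha)%:E = S%:E)%E).
Implicit Types f g : coefs R (seq nat).

Let V_ge0 alpha : 0 <= V alpha.
Proof. by rewrite VE mulr_ge0// ltW. Qed.

Let S_ge0 : 0 <= S.
Proof. by rewrite -lee_fin -sumS esum_ge0// => alpha _; rewrite lee_fin ltW. Qed.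

Let sum_le_S (gamma : seq nat) (part : nat -> seq nat) :
  {in [pred k | (k <= size gamma)%N] &, injective part} ->
  \sum_(k < (size gamma).+1) s (part k) <= S.
Proof.
move=> inj_part; rewrite -lee_fin -sumS -sumEFin.
rewrite -(big_mkord xpredT (fun k => (s (part k))%:E)).
rewrite -(big_map part xpredT (fun alpha => (s alpha)%:E)).
apply: big_le_esum => [alpha|]; first by rewrite lee_fin ltW.
rewrite map_inj_in_uniq ?iota_uniq// => k l.
by rewrite !mem_index_iota /= !ltnS => kg lg; exact: inj_part.
Qed.

Let cut_le f g gamma (part : nat -> seq nat) (T : nat -> R) :
  {in [pred k | (k <= size gamma)%N] &, injective part} ->
  (forall k, cabs (f (take k gamma)) ^+ 2 * cabs (g (drop k gamma)) ^+ 2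
     * V gamma = s (part k) * T k) ->
  cabs (fock_prod f g gamma) ^+ 2 * V gamma <=
  S * \sum_(k < (size gamma).+1) T k.
Proof.
move=> inj_part TE.
pose x (k : 'I_(size gamma).+1) := cabs (f (take k gamma)) * cabs (g (drop k gamma)).
have le_x : cabs (fock_prod f g gamma) <= \sum_k x k.
  apply: (le_trans (cabs_sum _ _)); apply: ler_sum => k _.
  by rewrite ComplexField.Normc.normcM.
have cauchy := @sqr_sum_le _ x (fun k => s (part k)) (fun k => s_gt0 _).
have sum_ge0 : 0 <= \sum_k x k ^+ 2 / s (part k).
  by apply: sumr_ge0 => k _; rewrite divr_ge0 ?sqr_ge0// ltW.
apply: (@le_trans _ _ ((S * \sum_k x k ^+ 2 / s (part k)) * V gamma)).
  rewrite ler_wpM2r//; apply: le_trans (le_trans cauchy _).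
    by rewrite lerXn2r ?nnegrE ?cabs_ge0// (le_trans (cabs_ge0 _) le_x).
  by rewrite ler_wpM2r// sum_le_S.
rewrite -mulrA ler_wpM2l// mulr_suml; apply: ler_sum => k _.
by rewrite /x exprMn mulrAC TE mulrAC mulfV ?mul1r// gt_eqF.
Qed.

Let scaled_cuts_le f g F G : (forall gamma,
    cabs (fock_prod f g gamma) ^+ 2 * V gamma <=
    S * \sum_(k < (size gamma).+1) F (take k gamma) * G (drop k gamma)) ->
  (forall alpha, 0 <= F alpha) -> (forall alpha, 0 <= G alpha) -> pos_summable G ->
  (sqnorm V (fock_prod f g) <=
   S%:E * ((\esum_(alpha in [set: seq nat]) (F alpha)%:E) *
           (\esum_(alpha in [set: seq nat]) (G alpha)%:E)))%E.
Proof.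
move=> le_cuts F0 G0 sG.
have sum0 gamma : 0 <= \sum_(k < (size gamma).+1) F (take k gamma) * G (drop k gamma).
  by apply: sumr_ge0 => k _; exact: mulr_ge0.
apply: (@le_trans _ _ (\esum_(gamma in [set: seq nat])
    (S * \sum_(k < (size gamma).+1) F (take k gamma) * G (drop k gamma))%:E)%E).
  by apply: le_esum => gamma _; rewrite lee_fin.
by rewrite esumZr// lee_wpmul2l ?lee_fin// esum_cuts_le.
Qed.

Lemma sqnorm_fock_prodl f g : ell2 V g ->
  (sqnorm V (fock_prod f g) <= S%:E * (sqnorm W f * sqnorm V g))%E.
Proof.
rewrite ell2E// => sg; apply: scaled_cuts_le => //; try exact: sqnorm_term_ge0.
move=> gamma; apply: (@cut_le f g gamma (take^~ gamma) (fun k =>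
  cabs (f (take k gamma)) ^+ 2 * W (take k gamma) *
  (cabs (g (drop k gamma)) ^+ 2 * V (drop k gamma)))) => [k l kg lg eq_kl|k].
  by rewrite -(size_takel kg) eq_kl size_takel.
by rewrite -{3}(cat_take_drop k gamma) V_cat [V (take _ _)]VE; ring.
Qed.

Lemma sqnorm_fock_prodr f g : ell2 W f ->
  (sqnorm V (fock_prod g f) <= S%:E * (sqnorm W f * sqnorm V g))%E.
Proof.
rewrite ell2E// (muleC (sqnorm W f)) => sf.
apply: scaled_cuts_le => //; try exact: sqnorm_term_ge0.
move=> gamma; apply: (@cut_le g f gamma (drop^~ gamma) (fun k =>
  cabs (g (take k gamma)) ^+ 2 * V (take k gamma) *
  (cabs (f (drop k gamma)) ^+ 2 * W (drop k gamma)))) => [k l kg lg eq_kl|k].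
  rewrite !inE in kg lg.
  have := congr1 size eq_kl; rewrite !size_drop => /(congr1 (subn (size gamma))).
  by rewrite !subKn.
by rewrite -{3}(cat_take_drop k gamma) V_cat [V (drop _ _)]VE; ring.
Qed.

End ProductEstimate.

End Words.

(** * Nuclearity of power scales *)

Section PowerScale.
Context {R : realType} {I : choiceType} (A : I -> R) (A_ge1 : forall i, 1 <= A i).
Context (d : nat) (A_sum : pos_summable (fun i => (A i ^+ d)^-1)).
Implicit Types (b : I -> R) (f g x : coefs R I) (B : set (coefs R I)).

Local Notation W := (fun (p : int) (i : I) => A i ^ p).
Local Notation V := (union_space W).
Local Notation P := [set dual_seminorm B | B in bounded_in_intersection W].

Let A_gt0 i : 0 < A i. Proof. exact: lt_le_trans ltr01 (A_ge1 i). Qed.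
Let Ap_gt0 i p : 0 < A i ^+ p. Proof. exact: exprn_gt0. Qed.
Let Ap_ge0 i p : 0 <= A i ^+ p. Proof. exact: ltW. Qed.
Let W_gt0 (p : int) i : 0 < A i ^ p. Proof. exact: exprz_gt0. Qed.
Let W_ge0 (p : int) i : 0 <= A i ^ p. Proof. exact: ltW. Qed.

(** The nonnegative families decaying faster than every power of [A].  They
    play the part of a basis of bounded sets of the intersection, and the
    seminorms [weighted_l1 b] that of a basis of seminorms of its dual. *)
Definition rapid b : Prop :=
  (forall i, 0 <= b i) /\ forall p : nat, pos_summable (fun i => b i * A i ^+ p).

Definition weighted_l1 b f : R :=
  fine (\esum_(i in [set: I]) (b i * cabs (f i))%:E)%E.

Definition majorized b : set (coefs R I) := [set x | forall i, cabs (x i) <= b i].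

Let prod_ge0 b f i : rapid b -> 0 <= b i * cabs (f i).
Proof. by case=> b0 _; rewrite mulr_ge0 ?cabs_ge0. Qed.

Lemma rapid0 : rapid (fun=> 0).
Proof.
by split=> // p; rewrite /pos_summable esum1 ?ltry// => i _; rewrite mul0r.
Qed.

Lemma rapidD b1 b2 : rapid b1 -> rapid b2 -> rapid (fun i => b1 i + b2 i).
Proof.
move=> [b1_ge0 s1] [b2_ge0 s2]; split=> [i|p]; first exact: addr_ge0.
have := pos_summableD (fun i => mulr_ge0 (b1_ge0 i) (Ap_ge0 i p))
  (fun i => mulr_ge0 (b2_ge0 i) (Ap_ge0 i p)) (s1 p) (s2 p).
by apply: pos_summable_le => i; rewrite mulrDl.
Qed.

Lemma rapidZ (c : R) b : 0 <= c -> rapid b -> rapid (fun i => c * b i).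
Proof.
move=> c0 [b0 sb]; split=> [i|p]; first exact: mulr_ge0.
have := pos_summableZ c0 (fun i => mulr_ge0 (b0 i) (Ap_ge0 i p)) (sb p).
by apply: pos_summable_le => i; rewrite mulrA.
Qed.

Lemma rapid_power b r : rapid b -> rapid (fun i => b i * A i ^+ r).
Proof.
move=> [b0 sb]; split=> [i|p]; first by rewrite mulr_ge0.
by apply: pos_summable_le (sb (r + p)%N) => i; rewrite exprD mulrA.
Qed.

Lemma rapid_sqr b p : rapid b -> pos_summable (fun i => b i ^+ 2 * A i ^+ p).
Proof.
move=> [b0 sb]; have fb := pos_summable_fin (fun i => mulr_ge0 (b0 i) (Ap_ge0 i 0)) (sb 0).
pose C := fine (\esum_(i in [set: I]) (b i * A i ^+ 0)%:E)%E.
have bC i : b i <= C.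
  rewrite -lee_fin fineK//; apply: le_trans (le_term_esum i _) => [|j].
    by rewrite expr0 mulr1.
  by rewrite lee_fin mulr_ge0.
have C0 : 0 <= C by rewrite fine_ge0// esum_ge0// => i _; rewrite lee_fin mulr_ge0.
have := pos_summableZ C0 (fun i => mulr_ge0 (b0 i) (Ap_ge0 i p)) (sb p).
apply: pos_summable_le => i; rewrite mulrA ler_wpM2r// expr2 ler_wpM2r//.
Qed.

Lemma rapid_pairing b f : rapid b -> V f -> pos_summable (fun i => b i * cabs (f i)).
Proof.
move=> rb [p _]; rewrite ell2E// => sf; have sb := rapid_sqr p rb.
have := pos_summableD (fun i => mulr_ge0 (sqr_ge0 (b i)) (Ap_ge0 i p))
  (sqnorm_term_ge0 (W_ge0 (- p%:Z)) f) sb sf.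
apply: pos_summable_le => i; rewrite -exprnN.
(* b z <= b^2 y + z^2 / y, and f lies in the space with weight 1 / y *)
set y := A i ^+ p; set z := cabs (f i).
have y0 : 0 < y by exact: Ap_gt0.
rewrite (_ : _ + _ = ((b i * y) ^+ 2 + z ^+ 2) / y); last by field; rewrite gt_eqF.
rewrite ler_pdivlMr//.
by have := sqr_ge0 (b i * y - z); have := sqr_ge0 (b i * y + z); nra.
Qed.

Lemma weighted_l1E b f : rapid b -> V f ->
  (\esum_(i in [set: I]) (b i * cabs (f i))%:E = (weighted_l1 b f)%:E)%E.
Proof.
move=> rb Vf; rewrite fineK// pos_summable_fin//; last exact: rapid_pairing.
by move=> i; exact: prod_ge0.
Qed.

Lemma weighted_l1_ge0 b f : rapid b -> 0 <= weighted_l1 b f.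
Proof.
by move=> rb; rewrite fine_ge0// esum_ge0// => i _; rewrite lee_fin prod_ge0.
Qed.

Lemma le_weighted_l1 b b' f : rapid b -> rapid b' -> V f ->
  (forall i, b i <= b' i) -> weighted_l1 b f <= weighted_l1 b' f.
Proof.
move=> rb rb' Vf bb'; rewrite -lee_fin -!weighted_l1E//; apply: le_esum => i _.
by rewrite lee_fin ler_wpM2r ?cabs_ge0.
Qed.

Lemma weighted_l1D b1 b2 f : rapid b1 -> rapid b2 -> V f ->
  weighted_l1 (fun i => b1 i + b2 i) f = weighted_l1 b1 f + weighted_l1 b2 f.
Proof.
move=> r1 r2 Vf; apply: EFin_inj; rewrite EFinD -!weighted_l1E//; last exact: rapidD.
rewrite -esumDr; try by move=> i; exact: prod_ge0.
by apply: eq_esum => i _; rewrite mulrDl.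
Qed.

Lemma weighted_l1Zl (c : R) b f : 0 <= c -> rapid b -> V f ->
  weighted_l1 (fun i => c * b i) f = c * weighted_l1 b f.
Proof.
move=> c0 rb Vf; apply: EFin_inj; rewrite EFinM -!weighted_l1E//; last exact: rapidZ.
rewrite -esumZr//; last by move=> i; exact: prod_ge0.
by apply: eq_esum => i _; rewrite mulrA.
Qed.

Lemma weighted_l1_seminorm b : rapid b -> seminorm_on V (weighted_l1 b).
Proof.
move=> rb; split=> [f g Vf Vg|c f Vf].
  have Bf i := prod_ge0 f i rb; have Bg i := prod_ge0 g i rb.
  have le_sum : (\esum_(i in [set: I]) (b i * cabs ((f + g)%R i))%:E <=
      (weighted_l1 b f + weighted_l1 b g)%:E)%E.
    rewrite EFinD -!weighted_l1E// -esumDr//; apply: le_esum => i _.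
    rewrite lee_fin -mulrDr ler_wpM2l ?(proj1 rb)//; exact: le_normcD.
  rewrite -lee_fin fineK// ge0_fin_numE ?(le_lt_trans le_sum) ?ltry//.
  by rewrite esum_ge0// => i _; rewrite lee_fin prod_ge0.
apply: EFin_inj; rewrite EFinM -(weighted_l1E rb Vf) -esumZr ?cabs_ge0//; last first.
  by move=> i; exact: prod_ge0.
rewrite -[LHS]/((fine _)%:E); have cE i :
    cabs c * (b i * cabs (f i)) = b i * cabs ((c *: f) i).
  rewrite -[(c *: f) i]/(c * f i : R[i]) ComplexField.Normc.normcM; ring.
under [in RHS]eq_esum => i _ do rewrite cE.
rewrite fineK// pos_summable_fin// => [i|]; first exact: prod_ge0.
have := pos_summableZ (cabs_ge0 c) (fun i => prod_ge0 f i rb) (rapid_pairing rb Vf).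
by apply: pos_summable_le => i; rewrite cE.
Qed.

(** One power [A ^ d] of the decay required of a bounded set is spent on
    summability. *)
Lemma bounded_majorized B : bounded_in_intersection W B ->
  exists2 b, rapid b & B `<=` majorized b.
Proof.
move=> bndB.
have bound (p : nat) : exists2 M : R, 0 <= M &
    forall x, B x -> forall i, cabs (x i) <= M / A i ^+ p.
  (* boundedness gives estimates for positive exponents only, hence 2p + 1 *)
  have [M le_M] := bndB p.*2.+1 isT; exists `|M| => // x Bx i.
  rewrite ler_pdivlMr// -[leLHS]ger0_norm ?mulr_ge0 ?cabs_ge0// -ler_sqr ?nnegrE//.
  rewrite !real_normK ?num_real//.
  have sq_le : (sqnorm (W p.*2.+1%:Z) x <= (M ^+ 2)%:E)%E.
    rewrite -sqr_wnorm => [|j]; last exact: W_ge0.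
    by rewrite EFin_expe !expe2 lee_pmul ?sqrte_ge0 ?le_M.
  apply: (@le_trans _ _ (cabs (x i) ^+ 2 * A i ^ p.*2.+1%:Z)).
    by rewrite exprMn ler_wpM2l ?sqr_ge0// -exprM muln2 -exprnP exprS ler_peMl.
  rewrite -lee_fin; apply: le_trans sq_le.
  apply: (@le_term_esum _ _ (fun j => (cabs (x j) ^+ 2 * A j ^ p.*2.+1%:Z)%:E)) => j.
  by rewrite lee_fin mulr_ge0 ?sqr_ge0 ?W_ge0.
pose b i := sup [set cabs (x i) | x in B].
have b_le (p : nat) : exists2 M : R, 0 <= M & forall i, b i <= M / A i ^+ p.
  have [M M0 le_M] := bound p; exists M => // i; rewrite /b.
  set D := [set _ | _ in _]; have [->|/set0P D0] := eqVneq D set0.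
    by rewrite sup0 divr_ge0.
  by apply: ge_sup => // _ [x Bx <-]; exact: le_M.
have le_b x i : B x -> cabs (x i) <= b i.
  move=> Bx; apply: ub_le_sup; last by exists x.
  have [M _ le_M] := bound 0; exists (M / A i ^+ 0) => _ [y By <-]; exact: le_M.
exists b => [|x Bx i]; last exact: le_b.
split=> [i|p].
  have [B0|/set0P[x Bx]] := eqVneq B set0; last by rewrite (le_trans (cabs_ge0 (x i)))// le_b.
  by rewrite /b B0 image_set0 sup0.
have [M M0 le_M] := b_le (p + d)%N.
have iA0 i : 0 <= (A i ^+ d)^-1 by rewrite invr_ge0.
apply: pos_summable_le (pos_summableZ M0 iA0 A_sum) => i.
by rewrite -ler_pdivlMr// -mulrA -invfM [A i ^+ d * _]mulrC -exprD.
Qed.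

Lemma pairing_le b x f : rapid b -> V f -> majorized b x ->
  cabs (csum (fun i => x i * f i)) <= weighted_l1 b f.
Proof.
move=> rb Vf xb.
have le_xb i : cabs (x i * f i) <= b i * cabs (f i).
  by rewrite ComplexField.Normc.normcM ler_wpM2r ?cabs_ge0.
have sxf : abs_summable (fun i => x i * f i).
  exact: pos_summable_le (rapid_pairing rb Vf).
rewrite -lee_fin -weighted_l1E//; apply: le_trans (cabs_csum_le sxf) _.
by apply: le_esum => i _; rewrite lee_fin.
Qed.

Lemma dual_seminorm_bounds B b f : rapid b -> V f -> B `<=` majorized b ->
  0 <= dual_seminorm B f <= weighted_l1 b f.
Proof.
move=> rb Vf Bb; rewrite /dual_seminorm; set D := [set _ | _ in _].
have ubD : ubound D (weighted_l1 b f) by move=> _ [x /Bb xb <-]; exact: pairing_le.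
have [->|D0] := eqVneq D set0; first by rewrite sup0 lexx weighted_l1_ge0.
have /set0P[y Dy] := D0; apply/andP; split; last by apply: ge_sup => //; exists y.
apply: (@le_trans _ _ y); last by apply: ub_le_sup => //; exists (weighted_l1 b f).
by case: Dy => x _ <-; exact: cabs_ge0.
Qed.

Lemma majorized_bounded b : rapid b -> bounded_in_intersection W (majorized b).
Proof.
move=> rb p _; have sb := rapid_sqr p rb.
have fb := pos_summable_fin (fun i => mulr_ge0 (sqr_ge0 (b i)) (Ap_ge0 i p)) sb.
exists (Num.sqrt (fine (\esum_(i in [set: I]) (b i ^+ 2 * A i ^+ p)%:E)%E)) => x xb.
rewrite -[X in (_ <= X)%E]/(sqrte (fine _)%:E) fineK//.
rewrite lee_sqrt; last by apply: esum_ge0 => i _; rewrite lee_fin mulr_ge0 ?sqr_ge0.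
apply: le_esum => i _; rewrite lee_fin ler_wpM2r//.
by rewrite lerXn2r ?nnegrE ?cabs_ge0 ?(proj1 rb).
Qed.

(** The supremum over [majorized b] is attained by aligning the phases. *)
Lemma weighted_l1_le_dual b f : rapid b -> V f ->
  weighted_l1 b f <= dual_seminorm (majorized b) f.
Proof.
move=> rb Vf; pose x : coefs R I := fun i => (b i)%:C * (conjc (f i) / (cabs (f i))%:C).
have b0 := proj1 rb.
have xb : majorized b x.
  move=> i; rewrite /x !ComplexField.Normc.normcM ComplexField.Normc.normcV.
  rewrite cabs_conj !cabs_real !ger0_norm ?cabs_ge0//.
  have [->|f0] := eqVneq (cabs (f i)) 0; first by rewrite mul0r mulr0.
  by rewrite mulfV// mulr1.
have xfE i : x i * f i = (b i * cabs (f i))%:C.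
  rewrite /x -mulrA [_ / _ * _]mulrAC [conjc _ * _]mulrC mulc_conj.
  have [->|f0] := eqVneq (cabs (f i)) 0.
    by rewrite expr0n mulr0 mul0r mulr0.
  rewrite expr2 [(_ * _)%:C in X in X / _]rmorphM mulfK ?rmorphM//.
  by apply/eqP => -[] /eqP; rewrite (negbTE f0).
have pairE : cabs (csum (fun i => x i * f i)) = weighted_l1 b f.
  rewrite (funext xfE) csum_real; [|by move=> i; exact: prod_ge0|exact: rapid_pairing].
  by rewrite cabs_real ger0_norm ?weighted_l1_ge0.
rewrite -{1}pairE /dual_seminorm; apply: ub_le_sup; last by exists x.
by exists (weighted_l1 b f) => _ [y yb <-]; exact: pairing_le.
Qed.

Lemma continuous_weighted_l1 b : rapid b -> continuous_seminorm V P (weighted_l1 b).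
Proof.
move=> rb; split; first exact: weighted_l1_seminorm.
exists [:: dual_seminorm (majorized b)], 1; split=> [r|f Vf].
  by rewrite inE => /eqP ->; exists (majorized b) => //; exact: majorized_bounded.
by rewrite big_seq1 mul1r; exact: weighted_l1_le_dual.
Qed.

Lemma continuous_seminorm_majorized p : continuous_seminorm V P p ->
  exists2 b, rapid b & forall f, V f -> p f <= weighted_l1 b f.
Proof.
move=> [_ [s [M [sP p_le]]]].
have [b rb sum_le] : exists2 b, rapid b &
    forall f, V f -> 0 <= \sum_(r <- s) r f <= weighted_l1 b f.
  elim: s sP {p_le} => [|r s ih] sP.
    exists (fun=> 0); first exact: rapid0.
    by move=> f _; rewrite big_nil lexx weighted_l1_ge0//; exact: rapid0.
  have [|b rb sum_le] := ih; first by move=> r' sr'; apply: sP; rewrite inE sr' orbT.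
  have [B /bounded_majorized[b' rb' Bb'] <-] := sP r (mem_head _ _).
  exists (fun i => b' i + b i); first exact: rapidD.
  move=> f Vf; rewrite big_cons weighted_l1D//.
  have /andP[? ?] := dual_seminorm_bounds rb' Vf Bb'; have /andP[? ?] := sum_le f Vf.
  by rewrite addr_ge0// lerD.
exists (fun i => `|M| * b i); first exact: rapidZ.
move=> f Vf; have /andP[s0 s_le] := sum_le f Vf.
rewrite weighted_l1Zl//; apply: (le_trans (p_le f Vf)).
by apply: (@le_trans _ _ (`|M| * \sum_(r <- s) r f)); rewrite ?ler_wpM2r ?ler_norm ?ler_wpM2l.
Qed.

Lemma seminorm_ge0 (p : coefs R I -> R) f : seminorm_on V p -> V f ->
  V (- f) -> 0 <= p f.
Proof.
move=> [pD pZ] Vf VNf.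
have p0 : p 0 = 0 by rewrite -(scale0r f) pZ// ComplexField.Normc.normc0 mul0r.
have pN : p (- f) = p f.
  by rewrite -scaleN1r pZ// normcN ComplexField.Normc.normc1 mul1r.
have := pD _ _ Vf VNf; rewrite subrr p0 pN; lra.
Qed.

(** A continuous seminorm is dominated by some [weighted_l1 b].  Raising the
    weight [b] by the factor [A ^ d] gives a continuous seminorm [q], and the
    expansion in the coordinate vectors shows that the canonical map is nuclear:
    the coordinate [i] has [q]-dual norm at most [(b i * A i ^ d)^-1], the vector
    [vec i] has size at most [b i], and the products are summable by hypothesis.
    Coordinates with [b i = 0] are invisible to the seminorm and are dropped. *)
Lemma nuclear_power_scale (e : nat -> I) : bijective e -> nuclear_union W.
Proof.
move=> [e' eK e'K] p cp; have [b rb p_le] := continuous_seminorm_majorized cp.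
have [b0 _] := rb; have rbd := rapid_power d rb.
pose q := weighted_l1 (fun i => b i * A i ^+ d).
have V_le f g : (forall i, cabs (f i) <= cabs (g i)) -> V g -> V f.
  by move=> fg [r r0 sg]; exists r => //; exact: ell2_le sg.
have V_vec i : V (vec i) by exists 1%N => //; exact: ell2_vec.
have p_ge0 f : V f -> 0 <= p f.
  move=> Vf; apply: (seminorm_ge0 (proj1 cp) Vf).
  by apply: (V_le _ f) => // i; rewrite normcN.
have b_le i : b i <= b i * A i ^+ d by rewrite ler_peMr// exprn_ege1.
exists q; split; first exact: continuous_weighted_l1.
  by move=> f Vf; apply: (le_trans (p_le f Vf)); exact: le_weighted_l1.
pose coord i f : R[i] := if b i == 0 then 0 else f i.
exists (fun n f => coord (e n) f), (fun n => (b (e n) * A (e n) ^+ d)^-1),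
  (fun n => vec (e n)).
have bd0 i : 0 <= b i * A i ^+ d by rewrite mulr_ge0.
split.
- move=> n c f g _ _; rewrite /coord; case: ifP => // _.
  by rewrite mulr0 addr0.
- move=> n; split=> [|f Vf]; first by rewrite invr_ge0.
  rewrite /coord; case: eqVneq => [_|bn].
    by rewrite ComplexField.Normc.normc0 mulr_ge0 ?invr_ge0// weighted_l1_ge0.
  rewrite ler_pdivlMl; last by rewrite mulr_gt0// lt_def bn b0.
  rewrite -lee_fin -weighted_l1E//.
  apply: (@le_term_esum _ _ (fun i => (b i * A i ^+ d * cabs (f i))%:E)) => i.
  by rewrite lee_fin mulr_ge0 ?cabs_ge0.
- by move=> n; exact: V_vec.
- have iA0 i : 0 <= (A i ^+ d)^-1 by rewrite invr_ge0.
  have fA := pos_summable_fin iA0 A_sum.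
  have term_ge0 n : 0 <= (b (e n) * A (e n) ^+ d)^-1 * p (vec (e n)).
    by rewrite mulr_ge0 ?invr_ge0 ?p_ge0.
  have term_le n : (b (e n) * A (e n) ^+ d)^-1 * p (vec (e n)) <= (A (e n) ^+ d)^-1.
    have [bn|bn] := eqVneq (b (e n)) 0; first by rewrite bn mul0r invr0 mul0r invr_ge0.
    have bn0 : 0 < b (e n) by rewrite lt_def bn b0.
    rewrite ler_pdivrMl ?mulr_gt0// mulrK ?unitfE ?gt_eqF//.
    apply: le_trans (p_le _ (V_vec _)) _.
    rewrite -lee_fin -weighted_l1E// (esum_single (j := e n)).
    - by rewrite /vec eqxx ComplexField.Normc.normc1 mulr1.
    - by rewrite lee_fin prod_ge0.
    - by move=> i /negbTE ien; rewrite /vec ien ComplexField.Normc.normc0 mulr0.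
  apply: nondecreasing_is_cvgn.
    by apply/nondecreasing_seqP => n; rewrite seriesEord/= big_ord_recr/= lerDl.
  exists (fine (\esum_(i in [set: I]) ((A i ^+ d)^-1)%:E)%E) => _ [N _ <-].
  rewrite seriesEnat/= -lee_fin fineK; last first.
    by rewrite pos_summable_fin// => i; rewrite invr_ge0.
  apply: (@le_trans _ _ (\sum_(0 <= n < N) ((A (e n) ^+ d)^-1)%:E)%E).
    by rewrite -sumEFin; apply: lee_sum => n _; rewrite lee_fin.
  rewrite -(big_map e xpredT (fun i => ((A i ^+ d)^-1)%:E)).
  apply: big_le_esum => [i|]; first by rewrite lee_fin invr_ge0.
  by rewrite map_inj_uniq ?iota_uniq//; exact: can_inj eK.
- move=> f Vf; pose s N := map e (index_iota 0 N).
  have us N : uniq (s N) by rewrite map_inj_uniq ?iota_uniq//; exact: can_inj eK.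
  pose rest N := f - \sum_(n < N) coord (e n) f *: vec (e n).
  have restE N i : rest N i = if (i \in s N) && (b i != 0) then 0 else f i.
    rewrite /rest -(big_mkord xpredT (fun n => coord (e n) f *: vec (e n))).
    rewrite -(big_map e xpredT (fun i => coord i f *: vec i)) -/(s N).
    rewrite -[LHS]/(f i - (\sum_(i <- s N) coord i f *: vec i) i).
    rewrite (vec_sum (fun i => coord i f))// /coord.
    by case: ifP => _; case: eqP => _ /=; rewrite ?subrr ?subr0.
  have Vrest N : V (rest N).
    apply: V_le Vf => i; rewrite restE; case: ifP => // _.
    by rewrite ComplexField.Normc.normc0 cabs_ge0.
  apply/cvgrPdist_lt => eps eps0.
  have [||t [_ tail]] := esum_tail (F := fun i => (b i * cabs (f i))%:E) _ _ eps0.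
  + by move=> i; rewrite lee_fin prod_ge0.
  + exact: rapid_pairing.
  exists (\max_(i <- t) (e' i).+1)%N => //= N leN.
  rewrite sub0r normrN ger0_norm; last exact: p_ge0 (Vrest N).
  apply: le_lt_trans (p_le _ (Vrest N)) _.
  rewrite -lte_fin -weighted_l1E//; apply: le_lt_trans (tail (s N) _).
    apply: le_esum => i _; rewrite restE; case: (i \in s N) => //=.
    case: eqVneq => [->|_]; first by rewrite mul0r.
    by rewrite ComplexField.Normc.normc0 mulr0.
  move=> i ti; apply/mapP; exists (e' i); last by rewrite e'K.
  rewrite mem_index_iota /=; apply: leq_trans leN.
  exact: (@leq_bigmax_seq _ _ xpredT (fun i => (e' i).+1)).
Qed.

End PowerScale.

(** * The Fock space over a scale of weighted spaces *)

Section Scale.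
Context {R : realType} (a : nat -> R) (a_ge1 : forall n, 1 <= a n).

Let a_gt0 n : 0 < a n. Proof. exact: lt_le_trans ltr01 (a_ge1 n). Qed.
Let Ka_gt0 (p : int) n : 0 < Kweight a p n. Proof. exact: exprz_gt0. Qed.

Lemma fock_weight_ge1 alpha : 1 <= fock_weight a alpha.
Proof.
elim: alpha => [|n alpha ih]; first by rewrite /fock_weight big_nil.
by rewrite fock_weight_cons -[1]mulr1 ler_pM.
Qed.

Lemma fock_weight_exprz (p : int) :
  fock_weight (Kweight a p) = (fun alpha => fock_weight a alpha ^ p).
Proof.
apply/funext; elim=> [|n alpha ih].
  by rewrite /fock_weight !big_nil exp1rz.
by rewrite !fock_weight_cons ih -expfzMl.
Qed.

Lemma summable_index_gt0 (d : int) : (weight_sum a d < 1)%E -> 0 < d.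
Proof.
move=> sum_lt1; rewrite ltNge; apply: contraL sum_lt1 => d_le0; rewrite -leNgt.
apply: le_trans (le_term_esum 0%N _) => [|n]; last first.
  by rewrite lee_fin ltW// exprz_gt0.
rewrite lee_fin -[- d]gez0_abs ?oppr_ge0//; exact: exprn_ege1.
Qed.

Lemma weight_sum_le (d r : int) : d <= r -> (weight_sum a r <= weight_sum a d)%E.
Proof.
move=> dr; apply: le_esum => n _; rewrite lee_fin.
by rewrite ler_weXz2l// lerN2.
Qed.

Lemma esum_fock_scale (r : int) : (weight_sum a r < 1)%E ->
  (\esum_(alpha in [set: seq nat]) (fock_weight a alpha ^ (- r))%:E =
   ((1 - fine (weight_sum a r))^-1)%:E)%E.
Proof.
move=> sum_lt1; have w0 n : 0 <= a n ^ (- r) by rewrite ltW ?exprz_gt0.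
have fin : (weight_sum a r \is a fin_num)%E.
  by rewrite pos_summable_fin// /pos_summable (lt_trans sum_lt1)// ltry.
rewrite -(@esum_fock_weight _ (Kweight a (- r)) (fine (weight_sum a r)))//.
- by apply: eq_esum => alpha _; rewrite fock_weight_exprz.
- by rewrite fineK.
- by rewrite -lte_fin fineK.
Qed.

Lemma GammaT_hs_esum (p q : int) : p <= q ->
  GammaT_hs a q p = sqrte (\esum_(alpha in [set: seq nat])
                             (fock_weight a alpha ^ (- (q - p)))%:E)%E.
Proof.
move=> pq; rewrite /GammaT_hs hs_norm_embedding.
- congr sqrte; apply: eq_esum => alpha _; rewrite !fock_weight_exprz.
  have W0 : fock_weight a alpha != 0.
    by rewrite gt_eqF// (lt_le_trans ltr01)// fock_weight_ge1.
  by rewrite opprB expfzDr// invr_expz.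
- by move=> alpha; exact: fock_weight_gt0.
- by move=> alpha; rewrite ltW// fock_weight_gt0.
- move=> f sf; apply: second_quantization_id => // n.
  by rewrite /Kweight ler_weXz2l.
Qed.

Lemma nuclear_fock_scale (d : int) : (weight_sum a d < 1)%E ->
  nuclear_union (fun p : int => fock_weight (Kweight a p)).
Proof.
move=> sum_lt1; have := summable_index_gt0 sum_lt1.
case: d sum_lt1 => // d sum_lt1 _.
rewrite (funext fock_weight_exprz).
apply: (@nuclear_power_scale _ _ _ fock_weight_ge1 d _ CodeSeq.decode).
  rewrite /pos_summable; under eq_esum => alpha _ do rewrite exprnN.
  by rewrite esum_fock_scale// ltry.
by exists CodeSeq.code; [exact: CodeSeq.decodeK|exact: CodeSeq.codeK].
Qed.

End Scale.

Theorem theorem3p3 (R : realType) (a : nat -> R) (d : int)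
    (a_ge1 : forall n, 1 <= a n) (nuc_a : nuclear_of_index a d) :
  nuclear_union (fun p : int => fock_weight (Kweight a p)) /\
  forall p q : int, p + d <= q ->
    [/\ forall f g : coefs R (seq nat), GammaK a (- p) f -> GammaK a (- q) g ->
          (Gnorm a q (fock_prod f g)
             <= GammaT_hs a q p * Gnorm a p f * Gnorm a q g)%E /\
          (Gnorm a q (fock_prod g f)
             <= GammaT_hs a q p * Gnorm a p f * Gnorm a q g)%E,
        GammaT_hs a q p
          = sqrte (\esum_(alpha in [set: seq nat])
                     (fock_weight a alpha ^ (- (q - p)))%:E),
        GammaT_hs a q p
          = ((sqrte (1 - \esum_(n in [set: nat]) (a n ^ (- (q - p)))%:E))^-1)%E
      & (GammaT_hs a q p < +oo)%E].
Proof.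
have [_ sum_lt1 _] := nuc_a; split; first exact: nuclear_fock_scale sum_lt1.
move=> p q pdq; have d_gt0 := summable_index_gt0 a_ge1 sum_lt1.
have pq : p <= q by apply: le_trans pdq; rewrite lerDl ltW.
have sum_r_lt1 : (weight_sum a (q - p) < 1)%E.
  by apply: le_lt_trans sum_lt1; apply: weight_sum_le => //; rewrite lerBrDl.
have a_gt0 n : 0 < a n by exact: lt_le_trans ltr01 (a_ge1 n).
have W_gt0 alpha : 0 < fock_weight a alpha.
  exact: lt_le_trans ltr01 (fock_weight_ge1 a_ge1 alpha).
have sum_S := esum_fock_scale a_ge1 sum_r_lt1.
have hsE := GammaT_hs_esum a_ge1 pq.
set t := fine (weight_sum a (q - p)) in sum_S.
have tE : weight_sum a (q - p) = t%:E.
  rewrite fineK// pos_summable_fin// => [n|]; first by rewrite ltW ?exprz_gt0.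
  by rewrite /pos_summable (lt_trans sum_r_lt1)// ltry.
have t_lt1 : t < 1 by rewrite -lte_fin -tE.
have S_gt0 : 0 < (1 - t)^-1 by rewrite invr_gt0 subr_gt0.
split=> //.
- move=> f g sf sg.
  have V_ge0 (r : int) alpha : 0 <= fock_weight (Kweight a r) alpha.
    by rewrite fock_weight_exprz// ltW ?exprz_gt0.
  have s_gt0 alpha : 0 < fock_weight a alpha ^ (- (q - p)) by exact: exprz_gt0.
  have V_eq alpha : fock_weight (Kweight a (- q)) alpha =
      fock_weight (Kweight a (- p)) alpha * fock_weight a alpha ^ (- (q - p)).
    rewrite !fock_weight_exprz// -expfzDr ?gt_eqF//; congr (_ ^ _); ring.
  have sqrt_le h : (sqnorm (fock_weight (Kweight a (- q))) h <=
        ((1 - t)^-1)%:E * (sqnorm (fock_weight (Kweight a (- p))) f *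
                           sqnorm (fock_weight (Kweight a (- q))) g))%E ->
      (Gnorm a q h <= GammaT_hs a q p * Gnorm a p f * Gnorm a q g)%E.
    move=> le_h; rewrite hsE sum_S /Gnorm /wnorm -muleA.
    have S_ge0 : (0 <= ((1 - t)^-1)%:E)%E by rewrite lee_fin ltW.
    rewrite -!sqrteM ?sqnorm_ge0// lee_sqrt//.
    by rewrite !mule_ge0 ?sqnorm_ge0.
  split; apply: sqrt_le.
    by apply: (sqnorm_fock_prodl (V_ge0 _) s_gt0 V_eq _ sum_S) => //; exact: fock_weight_cat.
  by apply: (sqnorm_fock_prodr (V_ge0 _) s_gt0 V_eq _ sum_S) => //; exact: fock_weight_cat.
- rewrite hsE sum_S -/(weight_sum a (q - p)) tE -EFinB /= inver.
  by rewrite sqrtr_eq0 subr_le0 leNgt t_lt1/= sqrtrV// subr_ge0 ltW.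
- by rewrite hsE sum_S /= ltry.
Qed.
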